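(* Let $f:K\to K'$ be an elementary simplicial map (elementary inclusion or elementary collapse) of finite simplicial complexes. Let $\{[\phi_i]\}$ be the cohomology basis for $H^p(K)$ given by a valid annotation for $K$ and let $\{\phi_i'\}$ be the cochains corresponding to the annotation computed for $K'$ by the update algorithm. Then $\{[\phi'_i]\}$ is a cohomology basis for $H^p(K')$.
   Context: Simplicial homology and cohomology are taken with $\mathbb{Z}_2$ coefficients; simplices are nonempty; $p\ge 0$ is any dimension. Annotations. An annotation for the $p$-simplices of $K$ assigns to each $p$-simplex $\sigma$ a vector $\mathsf a_\sigma\in\mathbb{Z}_2^{g}$ ($g$ depending only on $p$), extended to $p$-chains by $\mathsf a_c=\sum_{\sigma\in c}\mathsf a_\sigma$. It is valid if $g=\mathrm{rank}\,H_p(K)$ and any two $p$-cycles $z_1,z_2$ satisfy $\mathsf a_{z_1}=\mathsf a_{z_2}$ iff $[z_1]=[z_2]$. The cochains corresponding to an annotation are $\phi_i(\sigma)=\mathsf a_\sigma[i]$ ($i$-th entry), $1\le i\le g$; for a valid annotation they are cocycles whose classes form a basis of $H^p(K)$. ''A valid annotation for $K$'' means a valid annotation in every dimension. Elementary maps. An elementary inclusion is (up to renaming vertices) an inclusion $K\subseteq K'$ with at most one simplex in $K'\setminus K$. An elementary collapse is a simplicial map, surjective on simplices, induced by a vertex map sending two vertices $u\neq v$ to $u$ and fixing all other vertices. Update algorithm, elementary inclusion of a simplex $\sigma=K'\setminus K$ of dimension $q$ (if $K'=K$ nothing changes). Compute $\mathsf a_{\partial\sigma}$ in $K$ (the boundary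 of a vertex is $0$, with zero annotation). Case (i), $\mathsf a_{\partial\sigma}=0$: the annotation vector of every $q$-simplex $\tau\ne\sigma$ is extended by a last entry $0$, and $\sigma$ receives the annotation $[0,\dots,0,1]$ of the extended length; other dimensions are unchanged. Case (ii), $\mathsf a_{\partial\sigma}\neq 0$: let $w$ be the largest index of a nonzero entry of $\mathsf a_{\partial\sigma}$. Add $\mathsf a_{\partial\sigma}$ to the annotation of every $(q-1)$-simplex whose $w$-th entry is nonzero, then delete the $w$-th entry (now zero) from the annotations of all $(q-1)$-simplices; $\sigma$ receives the zero annotation in dimension $q$; all other annotations are unchanged. Update algorithm, elementary collapse $(u,v)\to u$. For a simplex $\sigma$ let $\mathrm{Lk}\,\sigma$ be the set of simplices $\omega$ disjoint from $\sigma$ with $\omega\cup\sigma$ in the complex. The pair $(u,v)$ satisfies the link condition if $\{u,v\}$ is a simplex and $\mathrm{Lk}\,u\cap\mathrm{Lk}\,v=\mathrm{Lk}\{u,v\}$. Step 1: let $S$ be the set of simplices whose absence from $K$ makes $(u,v)$ violate the link condition, i.e. those among $\{u,v\}$ and $\omega\cup\{u,v\}$ ($\omega\in\mathrm{Lk}\,u\cap\mathrm{Lk}\,v$) not in $K$; insert the simplices of $S$ in non-decreasing order of dimension, updating annotations by the inclusion rule, to obtain $\hat K=K\cup S$. Step 2 (annotation transfer): for every simplex $\sigma\in\hat K$ containing both $u$ and $v$ (a vanishing simplex), of dimension $q$, one after another, add the current $\mathsf a_\sigma$ to the annotations of all $q$-simplices of $\hat K$ containing $\sigma\setminus\{v\}$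 (including $\sigma$). After this, vanishing simplices have zero annotation and any two mirror simplices ($\omega\cup\{u\}$ and $\omega\cup\{v\}$ with $u,v\notin\omega$) have equal annotations. Step 3 (collapse): delete the vanishing simplices and replace $v$ by $u$ in every remaining simplex containing $v$, keeping annotations; i.e. a simplex of $K'$ gets the common annotation of the non-vanishing simplices of $\hat K$ of the same dimension mapped onto it. *)

(* Defs.v *)
From HB Require Import structures.
From mathcomp Require Import all_boot all_order all_algebra.

Set Implicit Arguments.
Unset Strict Implicit.
Unset Printing Implicit Defensive.

Import GRing.Theory.
Local Open Scope ring_scope.

(** * Finite simplicial complexes *)

Section Complexes.
Variable V : finType.
Implicit Types (K : {set {set V}}) (s t w : {set V}) (u v : V) (f : V -> V).

Definition simplicial_complex K : Prop :=
  set0 \notin K /\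
  forall s t, s \in K -> t \subset s -> t != set0 -> t \in K.

(* For the nonempty sets of a complex only; [sdim set0] is junk. *)
Definition sdim s : nat := #|s|.-1.

Definition simplices K (p : nat) : {set {set V}} := [set s in K | sdim s == p].

(* Excluding the empty [t] makes the boundary of a vertex equal to 0. *)
Definition facet t s : bool :=
  [&& t != set0, t \subset s & #|s| == #|t|.+1].

Definition map_complex f K : {set {set V}} :=
  [set f @: (s : {set V}) | s in K].

Definition simplicial_map f K K' : Prop := forall s, s \in K -> f @: s \in K'.

Definition link K s : {set {set V}} :=
  [set w in K | [disjoint w & s] && (w :|: s \in K)].

(* The injective [f] accounts for the renaming of vertices; [K'] may contain
   a vertex outside of [K] because [V] need not be exhausted by [K]. *)
Definition elementary_inclusion f K K' : Prop :=
  [/\ simplicial_map f K K',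
      {in [pred x | [set x] \in K] &, injective f}
    & (#|K' :\: map_complex f K| <= 1)%N].

Definition elementary_collapse f u v K K' : Prop :=
  [/\ u != v,
      [set u] \in K /\ [set v] \in K,
      forall x, [set x] \in K -> f x = if x == v then u else x,
      simplicial_map f K K'
    & forall t, t \in K' -> exists2 s, s \in K & f @: s = t].

Definition elementary_map f K K' : Prop :=
  elementary_inclusion f K K' \/ exists u v, elementary_collapse f u v K K'.

End Complexes.

(** * Quotient vector spaces *)

(* [U / B] is realised on a complement of [B]: [qclass B z] is the class of
   [z] modulo [B], and [quotv Z B] is the space [Z / B] for [B <= Z]. *)
Section Quotient.
Variables (F : fieldType) (U : vectType F).

Definition qclass (B : {vspace U}) : 'End(U) := daddv_pi B^C B.

Definition quotv (Z B : {vspace U}) : {vspace U} := (qclass B @: Z)%VS.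

Lemma lker_qclass (B : {vspace U}) : lker (qclass B) = B.
Proof.
have cap0 : (B^C :&: B = 0)%VS by rewrite capvC capv_compl.
have cap0' : (B :&: B^C = 0)%VS by rewrite capv_compl.
have dec z : qclass B z + daddv_pi B B^C z = z.
  by apply: daddv_pi_add => //; rewrite addvC addv_complf memvf.
apply/vspaceP => z; rewrite memv_ker; apply/eqP/idP => [z0 | Bz].
  by rewrite -[z]dec z0 add0r memv_pi.
by move: (dec z); rewrite (daddv_pi_id cap0' Bz) -[RHS]add0r => /addIr.
Qed.

Lemma eq_qclass (B : {vspace U}) z1 z2 :
  (qclass B z1 == qclass B z2) = (z1 - z2 \in B).
Proof. by rewrite -subr_eq0 -linearB /= -memv_ker lker_qclass. Qed.

End Quotient.

(** * Simplicial homology and cohomology over Z_2 *)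

(* Both p-chains and p-cochains of [K] are represented by functions on all
   subsets of [V] that vanish outside of the p-simplices of [K]. *)
Notation chain V := {ffun {set V} -> ('F_2)^o}.

Section Homology.
Variable V : finType.
Implicit Types (K : {set {set V}}) (s t : {set V}) (c : chain V) (p : nat).

Definition schain s : chain V := [ffun t => (t == s)%:R].

Definition chains K p : {vspace chain V} :=
  (\sum_(s in simplices K p) <[schain s]>)%VS.

Definition boundary c : chain V := [ffun t => \sum_(s | facet t s) c s].

Definition coboundary K c : chain V :=
  [ffun s => if s \in K then \sum_(t | facet t s) c t else 0].

Lemma boundary_is_linear : linear boundary.
Proof.
move=> a c1 c2; apply/ffunP => t; rewrite !ffunE scaler_sumr -big_split /=.
by apply: eq_bigr => s _; rewrite !ffunE.
Qed.

HB.instance Definition _ :=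
  GRing.isLinear.Build _ _ _ _ boundary boundary_is_linear.

Lemma coboundary_is_linear K : linear (coboundary K).
Proof.
move=> a c1 c2; apply/ffunP => s; rewrite !ffunE.
case: ifP => _; last by rewrite scaler0 addr0.
rewrite scaler_sumr -big_split /=.
by apply: eq_bigr => t _; rewrite !ffunE.
Qed.

HB.instance Definition _ K :=
  GRing.isLinear.Build _ _ _ _ (coboundary K) (coboundary_is_linear K).

Definition cycles K p : {vspace chain V} :=
  (chains K p :&: lker (linfun boundary))%VS.

Definition boundaries K p : {vspace chain V} :=
  (linfun boundary @: chains K p.+1)%VS.

Definition homology K p : {vspace chain V} :=
  quotv (cycles K p) (boundaries K p).

Definition cocycles K p : {vspace chain V} :=
  (chains K p :&: lker (linfun (coboundary K)))%VS.

Definition coboundaries K p : {vspace chain V} :=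
  if p is p'.+1 then (linfun (coboundary K) @: chains K p')%VS else 0%VS.

Definition cohomology K p : {vspace chain V} :=
  quotv (cocycles K p) (coboundaries K p).

Definition cohomology_basis K p (g : nat) (phi : 'I_g -> chain V) : Prop :=
  (forall i, phi i \in cocycles K p) /\
  basis_of (cohomology K p) [tuple qclass (coboundaries K p) (phi i) | i < g].

End Homology.

(** * Annotations *)

Section Annotations.
Variable V : finType.

(* An annotation in one dimension: only the vectors of the simplices of that
   dimension in the complex under consideration are meaningful. *)
Record layer := Layer { rk : nat; vec : {set V} -> 'rV['F_2]_rk }.

Definition annotation := nat -> layer.

Implicit Types (K : {set {set V}}) (s t : {set V}) (L : layer).
Implicit Types (a : annotation) (f : V -> V).

Definition ann_chain L (c : chain V) : 'rV['F_2]_(rk L) :=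
  \sum_s c s *: vec L s.

Definition valid_annotation K a : Prop :=
  forall p, rk (a p) = \dim (homology K p) /\
    forall z1 z2, z1 \in cycles K p -> z2 \in cycles K p ->
      ann_chain (a p) z1 = ann_chain (a p) z2 <->
      qclass (boundaries K p) z1 = qclass (boundaries K p) z2.

Definition ann_cochain K p L (i : 'I_(rk L)) : chain V :=
  [ffun s => if s \in simplices K p then vec L s 0 i else 0].

(** ** Update under the insertion of a simplex *)

Definition last_nonzero n (x : 'rV['F_2]_n) : option 'I_n :=
  [pick w | (x 0 w != 0) && [forall j, (x 0 j != 0) ==> (j <= w)%N]].

Lemma last_nonzeroE n (x : 'rV['F_2]_n) : (last_nonzero x == None) = (x == 0).
Proof.
rewrite /last_nonzero; case: pickP => [w /andP[xw _] | no].
  by apply/esym/eqP => x0; rewrite x0 mxE eqxx in xw.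
rewrite eqxx; apply/esym/eqP/rowP => i; rewrite mxE.
apply/eqP; apply: contraT => xi.
have [w xw wmax] :=
  @arg_maxnP _ i (fun j => x 0 j != 0) (@nat_of_ord n) xi.
have /negP[] := negbT (no w); rewrite xw /=.
by apply/forallP => j; apply/implyP => /wmax.
Qed.

Definition extend_layer L s : layer :=
  Layer (fun t => if t == s then row_mx 0 (const_mx 1) : 'rV_(rk L + 1)
                  else row_mx (vec L t) 0).

Definition cut_layer L (b : 'rV['F_2]_(rk L)) (w : 'I_(rk L)) : layer :=
  Layer (fun t => col' w (vec L t + (if vec L t 0 w != 0 then b else 0))).

Definition zero_layer L s : layer :=
  Layer (fun t => if t == s then 0 else vec L t).

(* If [s] is a vertex then [b] is 0, being the annotation of the zero chain,
   so that the [Some w] branch is only taken for [q > 0]. *)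
Definition insert_simplex a s : annotation :=
  let q := sdim s in
  let b := ann_chain (a q.-1) (boundary (schain s)) in
  if last_nonzero b is Some w then
    fun p => if p == q.-1 then cut_layer b w
             else if p == q then zero_layer (a q) s else a p
  else
    fun p => if p == q then extend_layer (a q) s else a p.

(** ** Update under a collapse *)

Definition missing_simplices K (u v : V) : {set {set V}} :=
  ([set u; v] |: [set w :|: [set u; v]
                     | w in link K [set u] :&: link K [set v]])
  :\: K.

Definition vanishing_simplices K (u v : V) : {set {set V}} :=
  [set s in K | (u \in s) && (v \in s)].

Definition transfer_layer K v L s : layer :=
  Layer (fun t =>
    if (t \in simplices K (sdim s)) && (s :\ v \subset t)
    then vec L t + vec L s else vec L t).

Definition transfer K v a s : annotation :=
  fun p => if p == sdim s then transfer_layer K v (a p) s else a p.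

(* Each simplex gets the annotation of a simplex of [K] of the same dimension
   mapped onto it by [f].  This serves both to rename vertices and to perform
   the last step of a collapse, where all such simplices have equal annotations. *)
Definition push_layer f K L : layer :=
  Layer (fun t => if [pick s : {set V} in K | (#|s| == #|t|) && (f @: s == t)] is Some s
                  then vec L s else 0).

Definition push_annotation f K a : annotation := fun p => push_layer f K (a p).

(** ** The annotations the update algorithm may compute *)

(* The sequences [ss] and [vs] are the orders in which the collapse inserts
   the missing simplices and processes the vanishing ones. *)
Inductive annotation_update f K K' a : annotation -> Prop :=
| UpdateTrivial of elementary_inclusion f K K' & K' = map_complex f K :
    annotation_update f K K' a (push_annotation f K a)
| UpdateInclusion s of elementary_inclusion f K K'
    & K' :\: map_complex f K = [set s] :
    annotation_update f K K' a (insert_simplex (push_annotation f K a) s)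
| UpdateCollapse u v (ss vs : seq {set V})
    (Khat := K :|: missing_simplices K u v)
    of elementary_collapse f u v K K'
    & perm_eq ss (enum (missing_simplices K u v))
    & sorted (fun s t => sdim s <= sdim t)%N ss
    & perm_eq vs (enum (vanishing_simplices Khat u v)) :
    annotation_update f K K' a
      (push_annotation f Khat
        (foldl (transfer Khat v) (foldl insert_simplex a ss) vs)).

End Annotations.

(* Main.v *)
(* Call an annotation layer adequate in dimension p ([annotates]) when, on
   p-cycles, it vanishes exactly on boundaries and is onto Z_2^g.  A valid annotation is
   adequate by a dimension count, and by duality adequacy makes the classes of
   the corresponding cochains a basis of cohomology; so it suffices that every
   step of the algorithm preserves adequacy.
   - Insertion of s: if the annotation of the boundary of s is 0 then s closes
     up to one new p-cycle, recorded by the new entry; otherwise its boundary b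
     becomes a boundary, and the update composes the annotation with a linear
     surjection whose kernel is spanned by the annotation of b.
   - Transfer at s: the annotation changes by a multiple of the coboundary of
     s - v, which does not affect its values on cycles.
   - Collapse: the induced chain map preserves annotations and is surjective on
     cycles: if c maps to a cycle, then its boundary k is in the kernel of the
     chain map, and so is the cone over k, which lies in the complex thanks to
     the link condition and has boundary k. *)

Require Import Defs.
From HB Require Import structures.
From mathcomp Require Import all_boot all_order all_algebra.

Set Implicit Arguments.
Unset Strict Implicit.
Unset Printing Implicit Defensive.

Import GRing.Theory.
Local Open Scope ring_scope.

(** * Arithmetic modulo 2 *)

Lemma F2_cases (x : 'F_2) : x = 0 \/ x = 1.
Proof.
case: x => [[|[|//]]] lt_x; by [left; apply: val_inj | right; apply: val_inj].
Qed.

Lemma F2_addrr (x : 'F_2) : x + x = 0.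
Proof. by case: (F2_cases x) => ->; apply: val_inj. Qed.

Lemma F2_oppr (x : 'F_2) : - x = x.
Proof. by case: (F2_cases x) => ->; apply: val_inj. Qed.

Lemma F2_rV_addrr n (x : 'rV['F_2]_n) : x + x = 0.
Proof. by apply/rowP => i; rewrite !mxE F2_addrr. Qed.

(** * Chains, boundaries and adequate annotations *)

Section Chains.
Variable V : finType.
Implicit Types (K : {set {set V}}) (s t : {set V}) (c z : chain V) (p : nat).

Lemma F2_chain_addrr c : c + c = 0.
Proof. by apply/ffunP => i; rewrite !ffunE F2_addrr. Qed.

Lemma mem_simplices K p s : (s \in simplices K p) = (s \in K) && (sdim s == p).
Proof. by rewrite inE. Qed.

Lemma card_sdim s x : x \in s -> #|s| = (sdim s).+1.
Proof. by move=> xs; rewrite prednK // card_gt0; apply/set0Pn; exists x. Qed.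

Lemma chain_addE c1 c2 t : (c1 + c2) t = c1 t + c2 t.
Proof. by rewrite ffunE. Qed.

Lemma chain_subE c1 c2 t : (c1 - c2) t = c1 t - c2 t.
Proof. by rewrite chain_addE [(- c2) t]ffunE. Qed.

Lemma chain_scaleE (k : ('F_2)^o) c t : (k *: c) t = k * c t.
Proof. by rewrite ffunE. Qed.

Lemma chain_sumE I (r : seq I) (P : pred I) (F : I -> chain V) t :
  (\sum_(i <- r | P i) F i) t = \sum_(i <- r | P i) F i t.
Proof.
by apply: (big_morph (fun c : chain V => c t)) => [c1 c2|]; rewrite ffunE.
Qed.

Lemma schainE s t : schain s t = (t == s)%:R.
Proof. by rewrite ffunE. Qed.

Lemma chain_sum c : c = \sum_s c s *: schain s.
Proof.
apply/ffunP => t; rewrite chain_sumE (bigD1 t) //= [X in _ = X + _]chain_scaleE.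
rewrite schainE eqxx.
rewrite mulr1 big1 ?addr0 // => s ne_st.
by rewrite chain_scaleE schainE eq_sym (negPf ne_st) mulr0.
Qed.

Lemma mem_chainsP K p c :
  reflect (forall s, s \notin simplices K p -> c s = 0) (c \in chains K p).
Proof.
apply: (iffP idP) => [/memv_sumP [e ce ->] s sK | c0].
  rewrite chain_sumE big1 // => t tK; have /vlineP [k ->] := ce t tK.
  rewrite chain_scaleE schainE; case: eqP => [st | _]; last by rewrite mulr0.
  by rewrite st tK in sK.
rewrite [c]chain_sum (bigID (mem (simplices K p))) /=.
rewrite [X in _ + X]big1 ?addr0 => [|s /c0 ->]; last by rewrite scale0r.
by apply: memv_sumr => s _; rewrite memvZ ?memv_line.
Qed.

Lemma chains_out K p c s :
  c \in chains K p -> s \notin simplices K p -> c s = 0.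
Proof. by move=> /mem_chainsP; apply. Qed.

Lemma schain_chains K p s : s \in simplices K p -> schain s \in chains K p.
Proof.
move=> sK; apply/mem_chainsP => t tK; rewrite ffunE.
by case: eqP => // st; rewrite st sK in tK.
Qed.

Lemma mem_cycles K p z :
  (z \in cycles K p) = (z \in chains K p) && (boundary z == 0).
Proof. by rewrite memv_cap memv_ker lfunE. Qed.

Lemma mem_boundariesP K p z :
  reflect (exists2 c, c \in chains K p.+1 & z = boundary c)
          (z \in boundaries K p).
Proof.
by apply: (iffP memv_imgP) => -[c Kc ->]; exists c; rewrite ?lfunE.
Qed.

(** If [t] arises from [r] by removing two vertices, exactly two simplices lie strictly between
    them, one for each removed vertex, and their contributions cancel modulo 2. *)
Lemma boundary_boundary c : boundary (boundary c) = 0.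
Proof.
apply/ffunP => t; rewrite !ffunE.
under eq_bigr do rewrite ffunE.
rewrite (exchange_big_dep predT) //= big1 // => r _.
rewrite sumr_const.
case: (boolP [exists s, facet t s && facet s r]) =>
  [/existsP[s0 /andP[ts0 s0r]] | no]; last first.
  rewrite [X in _ *+ X]eq_card0 ?mulr0n // => s; apply/negP.
  by move: no; rewrite negb_exists => /forallP/(_ s)/negP.
have /and3P[t0 tss0 /eqP cs0] := ts0; have /and3P[_ s0sr /eqP cr] := s0r.
have tr : t \subset r by apply: subset_trans s0sr.
have /cards2P[x [y [ne_xy rt]]] : #|r :\: t| == 2%N.
  by rewrite cardsD (setIidPr tr) cr cs0 -add2n addnK.
have xy_r x0 : x0 \in r -> x0 \notin t -> (x0 == x) || (x0 == y).
  by move=> x0r x0t; have : x0 \in r :\: t by [rewrite inE x0t];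
    rewrite rt !inE.
have [xt xr] : x \notin t /\ x \in r.
  by apply/andP; rewrite -in_setD rt !inE eqxx.
have [yt yr] : y \notin t /\ y \in r.
  by apply/andP; rewrite -in_setD rt !inE eqxx orbT.
rewrite (_ : #|_| = #|[set x |: t; y |: t]|); last first.
  apply: eq_card => s; rewrite !inE unfold_in; apply/andP/orP.
    case=> /and3P[_ ts /eqP cs] /and3P[_ sr _].
    have /cards1P[x0 st] : #|s :\: t| == 1%N.
      by rewrite cardsD (setIidPr ts) cs subSnn.
    have [x0t x0s] : x0 \notin t /\ x0 \in s.
      by apply/andP; rewrite -in_setD st !inE eqxx.
    have -> : s = x0 |: t.
      by rewrite -st setUC -[LHS](setID s t) (setIidPr ts).
    by case/orP: (xy_r x0 (subsetP sr _ x0s) x0t) => /eqP ->; [left|right].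
  have main x0 : x0 \notin t -> x0 \in r ->
      facet t (x0 |: t) && facet (x0 |: t) r.
    move=> x0t x0r; rewrite /facet t0 subsetUr cardsU1 x0t add1n eqxx /=.
    rewrite subUset sub1set x0r tr cr cs0 eqxx !andbT.
    by apply/set0Pn; exists x0; rewrite !inE eqxx.
  by case=> /eqP ->; apply/andP; apply: main.
rewrite cards2 (_ : x |: t != y |: t); last first.
  apply/eqP => /setP/(_ x); rewrite !inE eqxx /= (negPf xt) orbF.
  by move/esym/eqP => exy; rewrite exy eqxx in ne_xy.
by rewrite mulr2n F2_addrr.
Qed.

Lemma boundary_chains K p c : simplicial_complex K ->
  c \in chains K p.+1 -> boundary c \in chains K p.
Proof.
move=> [_ Kcl] /mem_chainsP c0; apply/mem_chainsP => t tK.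
rewrite ffunE big1 // => s /and3P[t0 ts /eqP cs]; apply: c0.
apply: contra tK; rewrite !mem_simplices => /andP[sK /eqP ps].
rewrite (Kcl s t) //=; move: ps; rewrite /sdim cs /= => ->.
by [].
Qed.

Lemma boundary_chains0 K c : c \in chains K 0 -> boundary c = 0.
Proof.
move=> /mem_chainsP c0; apply/ffunP => t.
rewrite !ffunE big1 // => s /and3P[t0 ts /eqP cs]; apply: c0.
rewrite mem_simplices negb_and /sdim cs /=.
by rewrite -lt0n card_gt0 t0 orbT.
Qed.

Lemma boundary_cycle K p c : simplicial_complex K ->
  c \in chains K p.+1 -> boundary c \in cycles K p.
Proof.
by move=> cK Kc; rewrite mem_cycles boundary_chains //= boundary_boundary.
Qed.

Lemma ann_chain_is_linear (L : layer V) : linear (ann_chain L).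
Proof.
move=> k c1 c2; rewrite /ann_chain scaler_sumr -big_split /=.
by apply: eq_bigr => s _; rewrite !ffunE scalerDl scalerA.
Qed.

HB.instance Definition _ (L : layer V) :=
  GRing.isLinear.Build _ _ _ _ (ann_chain L) (ann_chain_is_linear L).

Lemma ann_schain (L : layer V) s : ann_chain L (schain s) = vec L s.
Proof.
rewrite /ann_chain (bigD1 s) //= big1 ?addr0 => [|t ne_ts].
  by rewrite ffunE eqxx scale1r.
by rewrite ffunE (negPf ne_ts) scale0r.
Qed.

Lemma boundary0 : boundary (0 : chain V) = 0. Proof. exact: linear0. Qed.

Lemma boundaryD c1 c2 : boundary (c1 + c2) = boundary c1 + boundary c2.
Proof. exact: linearD. Qed.

Lemma boundaryB c1 c2 : boundary (c1 - c2) = boundary c1 - boundary c2.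
Proof. exact: linearB. Qed.

Lemma boundaryZ (k : ('F_2)^o) c : boundary (k *: c) = k *: boundary c.
Proof. exact: linearZ. Qed.

Lemma ann_chain0 (L : layer V) : ann_chain L 0 = 0. Proof. exact: linear0. Qed.

Lemma ann_chainD (L : layer V) c1 c2 :
  ann_chain L (c1 + c2) = ann_chain L c1 + ann_chain L c2.
Proof. exact: linearD. Qed.

Lemma ann_chainB (L : layer V) c1 c2 :
  ann_chain L (c1 - c2) = ann_chain L c1 - ann_chain L c2.
Proof. exact: linearB. Qed.

Lemma ann_chainZ (L : layer V) (k : ('F_2)^o) c :
  ann_chain L (k *: c) = k *: ann_chain L c.
Proof. exact: linearZ. Qed.

(** Surjectivity takes the place of the rank equality in [valid_annotation], so that no update step
    needs a dimension count. *)
Definition annotates K p (L : layer V) : Prop :=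
  (forall z, z \in cycles K p ->
     ann_chain L z = 0 <-> z \in boundaries K p) /\
  (forall x, exists2 z, z \in cycles K p & ann_chain L z = x).

(** On cycles the annotation and the quotient map have the same kernel, hence images of equal
    dimension. That dimension is [rk (a p)], so the annotation is onto. *)
Lemma valid_annotates K (a : annotation V) p :
  valid_annotation K a -> annotates K p (a p).
Proof.
move=> /(_ p)[rk_a valid].
(* Validity is used with the zero cycle as second argument. *)
have ker z : z \in cycles K p ->
    ann_chain (a p) z = 0 <-> z \in boundaries K p.
  move=> Zz; have [zB Bz] := valid z 0 Zz (mem0v _); rewrite linear0 in zB Bz.
  rewrite -[X in X \in _]subr0 -eq_qclass; by split=> [/zB -> | /eqP].
split=> // x.
have capE : (cycles K p :&: lker (linfun (ann_chain (a p))))%VS =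
            (cycles K p :&: lker (qclass (boundaries K p)))%VS.
  apply/vspaceP => z; rewrite lker_qclass.
  rewrite 2!(memv_cap z (cycles K p)).
  have [Zz /=|//] := boolP (z \in cycles K p).
  rewrite memv_ker lfunE.
  by apply/eqP/idP => /(ker z Zz).
have dimE : \dim (linfun (ann_chain (a p)) @: cycles K p)%VS =
            \dim (homology K p).
  have dim_a := limg_ker_dim (linfun (ann_chain (a p))) (cycles K p).
  have dim_q := limg_ker_dim (qclass (boundaries K p)) (cycles K p).
  by move: dim_a; rewrite capE -[RHS]dim_q; apply: addnI.
have full : (linfun (ann_chain (a p)) @: cycles K p = fullv)%VS.
  by apply/eqP; rewrite eqEdim subvf dimE -rk_a dimvf /dim /= mul1n /=.
have : x \in fullv by apply: memvf.
by rewrite -full => /memv_imgP[z Zz ->]; exists z; rewrite ?lfunE.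
Qed.

End Chains.

(** * Duality between chains and cochains *)

Section Duality.
Variable V : finType.
Implicit Types (K : {set {set V}}) (s t : {set V}) (p : nat).
Implicit Types (c z phi psi : chain V) (L : layer V).

Definition pairing phi c : ('F_2)^o := \sum_s phi s * c s.

Lemma pairing_is_linear phi : linear (pairing phi).
Proof.
move=> k c1 c2; rewrite /pairing scaler_sumr -big_split /=.
by apply: eq_bigr => s _; rewrite chain_addE chain_scaleE mulrDr mulrCA.
Qed.

HB.instance Definition _ phi :=
  GRing.isLinear.Build _ _ _ _ (pairing phi) (pairing_is_linear phi).

Lemma pairingC phi c : pairing phi c = pairing c phi.
Proof. by apply: eq_bigr => s _; rewrite mulrC. Qed.

Lemma pairing_schain phi s : pairing phi (schain s) = phi s.
Proof.
rewrite /pairing (bigD1 s) //= schainE eqxx mulr1 big1 ?addr0 // => t ne_ts.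
by rewrite schainE (negPf ne_ts) mulr0.
Qed.

(** Both sides sum over the same pairs of a simplex and a facet. Since [coboundary] is cut off
    outside [K], the chain [c] has to be supported in [K]. *)
Lemma pairing_coboundary K p psi c : c \in chains K p ->
  pairing (coboundary K psi) c = pairing psi (boundary c).
Proof.
move=> /mem_chainsP c0; rewrite /pairing.
have -> : \sum_s coboundary K psi s * c s =
          \sum_s \sum_(t | facet t s) psi t * c s.
  apply: eq_bigr => s _; rewrite ffunE; case: ifP => [_ | sK].
    by rewrite big_distrl.
  by rewrite c0 ?mem_simplices ?sK // mul0r big1 // => t _; rewrite mulr0.
rewrite (exchange_big_dep predT) //=.
by apply: eq_bigr => t _; rewrite ffunE big_distrr.
Qed.

(** By adjointness the coboundary of [phi] at a simplex [s] is the value of [phi] on the boundary of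
    [s], and only simplices of dimension [p.+1] have facets of dimension [p]. *)
Lemma mem_cocyclesP K p phi : phi \in chains K p ->
  reflect (forall c, c \in chains K p.+1 -> pairing phi (boundary c) = 0)
          (phi \in cocycles K p).
Proof.
move=> Kphi; rewrite memv_cap Kphi memv_ker lfunE /=.
apply: (iffP eqP) => [dphi c Kc | phi0].
  by rewrite -(pairing_coboundary _ Kc) dphi pairingC linear0.
apply/ffunP => s; rewrite [RHS]ffunE.
have [sK | sK] := boolP (s \in simplices K p.+1).
  rewrite -pairing_schain (pairing_coboundary _ (schain_chains sK)).
  by rewrite phi0 ?schain_chains.
rewrite ffunE; case: ifP => // Ks; rewrite big1 // => t /and3P[t0 ts /eqP cs].
apply: (chains_out Kphi); apply: contra sK.
rewrite !mem_simplices Ks /sdim cs /= => /andP[_ /eqP <-].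
by rewrite prednK // card_gt0.
Qed.

(** The projection onto [chains K p]. It turns the boundary on [chains K p.+1] into a linear map on
    the whole space, for which a generalised inverse is available. *)
Definition restrict K p c : chain V :=
  [ffun s => if s \in simplices K p then c s else 0].

Lemma restrict_is_linear K p : linear (restrict K p).
Proof.
move=> k c1 c2; apply/ffunP => s; rewrite chain_addE chain_scaleE !ffunE.
by case: ifP => // _; rewrite mulr0 addr0.
Qed.

HB.instance Definition _ K p :=
  GRing.isLinear.Build _ _ _ _ (restrict K p) (restrict_is_linear K p).

Lemma restrict_chains K p c : restrict K p c \in chains K p.
Proof. by apply/mem_chainsP => s sK; rewrite ffunE (negPf sK). Qed.

Lemma restrict_id K p c : c \in chains K p -> restrict K p c = c.
Proof.
move=> /mem_chainsP c0; apply/ffunP => s; rewrite ffunE.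
by case: ifP => // /negbT /c0 ->.
Qed.

(** A functional that vanishes on the kernel of the boundary factors through the boundary, and the
    factor is the cochain whose coboundary it is. *)
Lemma mem_coboundariesP K p phi : simplicial_complex K -> phi \in chains K p ->
  reflect (forall z, z \in cycles K p -> pairing phi z = 0)
          (phi \in coboundaries K p).
Proof.
move=> cK Kphi; apply: (iffP idP) => [|phi0].
  case: p Kphi => [|p] Kphi.
    by rewrite memv0 => /eqP -> z _; rewrite pairingC linear0.
  move=> /memv_imgP[psi Kpsi ->] z; rewrite mem_cycles lfunE /=.
  by move=> /andP[Kz /eqP dz]; rewrite (pairing_coboundary _ Kz) dz linear0.
case: p Kphi phi0 => [|p] Kphi phi0.
  (* In dimension 0 each vertex is itself a cycle, so [phi] is 0, the only coboundary there. *)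
  rewrite memv0; apply/eqP/ffunP => s; rewrite [RHS]ffunE.
  have [sK | sK] := boolP (s \in simplices K 0); last exact: (chains_out Kphi).
  rewrite -pairing_schain phi0 // mem_cycles schain_chains //=.
  by rewrite (@boundary_chains0 _ K) // schain_chains.
(* The cochain [psi] is [phi] composed with a right inverse of the boundary on its image, recorded
   on the basis of simplices. *)
pose d := linfun (@boundary V \o restrict K p.+1).
have dE c : d c = boundary (restrict K p.+1 c) by rewrite lfunE.
pose psi : chain V :=
  [ffun t => pairing phi (restrict K p.+1 (d^-1%VF (schain t)))].
have psiE y : pairing psi y = pairing phi (restrict K p.+1 (d^-1%VF y)).
  rewrite {2}[y]chain_sum !linear_sum /=.
  by apply: eq_bigr => t _; rewrite !linearZ /= mulrC [psi t]ffunE.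
apply/memv_imgP; exists (restrict K p psi); first exact: restrict_chains.
rewrite lfunE /=; apply/ffunP => s.
have Kd : coboundary K (restrict K p psi) \in chains K p.+1.
  apply/mem_chainsP => t tK; rewrite ffunE; case: ifP => // Kt.
  rewrite big1 // => r /and3P[r0 rt /eqP cr]; rewrite ffunE ifN //.
  apply: contra tK; rewrite !mem_simplices Kt /sdim cr /= => /andP[_ /eqP <-].
  by rewrite prednK // card_gt0.
have [sK | sK] := boolP (s \in simplices K p.+1); last first.
  by rewrite (chains_out Kphi sK) (chains_out Kd sK).
have Ks := schain_chains sK.
rewrite -!pairing_schain (pairing_coboundary _ Ks).
set y := boundary (schain s).
have -> : pairing (restrict K p psi) y = pairing psi y.
  have /mem_chainsP Ky : y \in chains K p by apply: boundary_chains.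
  apply: eq_bigr => t _; rewrite [restrict _ _ _ _]ffunE.
  by case: ifP => // /negbT/Ky ->; rewrite !mulr0.
rewrite psiE; apply/eqP; rewrite -subr_eq0 -linearB /=; apply/eqP/phi0.
(* As [y] lies in the image of [d], the chosen preimage has the same boundary as [schain s]; their
   difference is a cycle, on which [phi] vanishes. *)
have dy : d (d^-1%VF y) = y.
  by apply: limg_lfunVK; apply/memv_imgP; exists (schain s);
    rewrite ?memvf // dE restrict_id.
rewrite mem_cycles rpredB ?restrict_chains //= linearB /=.
by rewrite -dE dy subrr.
Qed.

Lemma ann_cochain_chains K p L i : ann_cochain K p (L := L) i \in chains K p.
Proof. by apply/mem_chainsP => s sK; rewrite ffunE (negPf sK). Qed.

Lemma pairing_ann_cochain K p L i c : c \in chains K p ->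
  pairing (ann_cochain K p (L := L) i) c = ann_chain L c 0 i.
Proof.
move=> /mem_chainsP c0; rewrite /pairing /ann_chain summxE.
apply: eq_bigr => s _; rewrite mxE ffunE.
by case: ifP => [_ | /negbT/c0 ->]; [rewrite mulrC | rewrite mulr0 mul0r].
Qed.

(** The cochains read off the entries of the annotation, so they vanish on boundaries and are
    cocycles. Cycles annotated by the unit vectors form a dual family, which yields both spanning
    and independence. *)
Lemma annotates_cohomology_basis K p L : simplicial_complex K ->
  annotates K p L -> cohomology_basis K p (ann_cochain K p (L := L)).
Proof.
move=> cK [ker surj]; set phi := ann_cochain K p (L := L).
have Kphi i : phi i \in chains K p by apply: ann_cochain_chains.
have cocycle i : phi i \in cocycles K p.
  apply/mem_cocyclesP => // c Kc; have Zdc := boundary_cycle cK Kc.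
  rewrite pairing_ann_cochain; last by case/memv_capP: Zdc.
  suff -> : ann_chain L (boundary c) = 0 by rewrite mxE.
  by apply/ker => //; apply/mem_boundariesP; exists c.
have [z Zz annz] := fin_all_exists2 (fun i => surj (delta_mx 0 i)).
have Kz i : z i \in chains K p by case/memv_capP: (Zz i).
have phiz (k : 'I_(rk L) -> ('F_2)^o) y : y \in chains K p ->
    pairing (\sum_i k i *: phi i) y = \sum_i k i * ann_chain L y 0 i.
  move=> Ky; rewrite pairingC linear_sum; apply: eq_bigr => i _.
  by rewrite linearZ /= pairingC pairing_ann_cochain.
have Ksum (k : 'I_(rk L) -> ('F_2)^o) : \sum_i k i *: phi i \in chains K p.
  by apply: memv_suml => i _; apply: memvZ.
split=> //; rewrite /basis_of; apply/andP; split.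
  rewrite eqEsubv; apply/andP; split.
    apply/span_subvP => x /mapP[i _ ->]; exact: memv_img.
  apply/subvP => x /memv_imgP[psi Zpsi ->].
  have Kpsi : psi \in chains K p by case/memv_capP: Zpsi.
  (* The coefficients of [psi] are its values on the dual cycles. Two cochains that agree on all
     cycles are cohomologous. *)
  pose k i := pairing psi (z i).
  have -> : qclass (coboundaries K p) psi =
            qclass (coboundaries K p) (\sum_i k i *: phi i).
    apply/eqP; rewrite eq_qclass; apply/mem_coboundariesP => //.
      by rewrite rpredB.
    move=> y Zy; have Ky : y \in chains K p by case/memv_capP: Zy.
    rewrite pairingC linearB /= !(pairingC y) phiz //.
    (* The combination of dual cycles with the annotation of [y]: the difference [y - y'] bounds,
       and the cocycle [psi] vanishes on it. *)
    pose y' := \sum_i ann_chain L y 0 i *: z i.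
    have /ker : y - y' \in cycles K p.
      by apply: memvB Zy _; apply: memv_suml => i _; apply: memvZ (Zz i).
    have ann_y' : ann_chain L y' = ann_chain L y.
      rewrite [LHS]linear_sum [RHS]row_sum_delta; apply: eq_bigr => i _.
      by rewrite linearZ /= annz.
    rewrite [ann_chain L _]linearB /= ann_y' subrr.
    case=> /(_ erefl) /mem_boundariesP[c Kc dc] _.
    have <- : pairing psi y' = \sum_i k i * ann_chain L y 0 i.
      rewrite [LHS]linear_sum; apply: eq_bigr => i _.
      by rewrite [LHS]linearZ mulrC.
    transitivity (pairing psi (y - y')); first by rewrite [RHS]linearB.
    by rewrite dc; move/(mem_cocyclesP Kpsi): Zpsi; apply.
  rewrite linear_sum; apply: memv_suml => i _; rewrite linearZ; apply: memvZ.
  apply: memv_span; apply/mapP; exists i; rewrite ?mem_enum //.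
apply/freeP => k /=.
under eq_bigr do rewrite nth_mktuple -linearZ.
rewrite -linear_sum => /eqP k0 i.
(* A coboundary vanishes on the cycle [z i], where this combination takes the value [k i]. *)
have : \sum_i k i *: phi i \in coboundaries K p.
  by rewrite -[X in X \in _]subr0 -eq_qclass linear0.
move/mem_coboundariesP => /(_ cK (Ksum k) (z i) (Zz i)).
rewrite phiz // annz (bigD1 i) //= big1 ?addr0 => [|j ne_ji].
  by rewrite mxE !eqxx mulr1.
by rewrite mxE (negPf ne_ji) mulr0.
Qed.

End Duality.

(** * Insertion of simplices *)

Section Insertion.
Variable V : finType.
Implicit Types (K : {set {set V}}) (s t : {set V}) (p : nat).
Implicit Types (c z : chain V) (L : layer V) (a : annotation V).

(** The common length [n] is explicit so that the two annotations of a chain have the same type. *)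
Lemma annotates_eq_rk K p n (vec1 vec2 : {set V} -> 'rV['F_2]_n) :
  (forall z, z \in cycles K p ->
     ann_chain (Layer vec1) z = ann_chain (Layer vec2) z) ->
  annotates K p (Layer vec1) -> annotates K p (Layer vec2).
Proof.
move=> e12 [ker surj]; split=> [z Zz | x]; first by rewrite -e12 //; apply: ker.
by have [z Zz <-] := surj x; exists z; rewrite // e12.
Qed.

Lemma eq_annotates K K' p L :
  simplices K p = simplices K' p -> boundaries K p = boundaries K' p ->
  annotates K p L -> annotates K' p L.
Proof. by rewrite /annotates /cycles /chains => -> ->. Qed.

Lemma eq_ann_chain K p n (vec1 vec2 : {set V} -> 'rV['F_2]_n) c :
  {in simplices K p, vec1 =1 vec2} -> c \in chains K p ->
  ann_chain (Layer vec1) c = ann_chain (Layer vec2) c.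
Proof.
move=> e12 Kc; apply: eq_bigr => s _ /=.
have [sK | sK] := boolP (s \in simplices K p); first by rewrite e12.
by rewrite (chains_out Kc sK) !scale0r.
Qed.

Lemma simplices_insert_neq K s p :
  p != sdim s -> simplices (s |: K) p = simplices K p.
Proof.
move=> ne_ps; apply/setP => t; rewrite !mem_simplices !inE.
by case: (t =P s) => [-> | //]; rewrite eq_sym (negPf ne_ps) !andbF.
Qed.

Lemma chains_insert K s c : c \in chains (s |: K) (sdim s) ->
  c - c s *: schain s \in chains K (sdim s).
Proof.
move=> K'c; apply/mem_chainsP => t tK.
rewrite chain_subE chain_scaleE schainE.
have [-> | ne_ts] := eqVneq t s; first by rewrite mulr1 subrr.
rewrite mulr0 subr0; apply: (chains_out K'c).
by rewrite mem_simplices !inE (negPf ne_ts) -mem_simplices.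
Qed.

Lemma schain_chains_insert K s : schain s \in chains (s |: K) (sdim s).
Proof. by apply: schain_chains; rewrite mem_simplices setU11 eqxx. Qed.

Lemma chains_sub K K' p c :
  {subset K <= K'} -> c \in chains K p -> c \in chains K' p.
Proof.
move=> KK' Kc; apply/mem_chainsP => s sK'; apply: (chains_out Kc).
by apply: contra sK'; rewrite !mem_simplices => /andP[/KK' -> ->].
Qed.

Lemma schain_boundary_cycle K s q : sdim s = q.+1 ->
  simplicial_complex (s |: K) -> boundary (schain s) \in cycles K q.
Proof.
move=> sq cK'; have := schain_chains_insert K s; rewrite sq => K's.
have := boundary_cycle cK' K's.
by rewrite /cycles /chains simplices_insert_neq // sq neq_ltn ltnSn.
Qed.

Lemma ann_chain_extend K s L c : s \notin K -> c \in chains K (sdim s) ->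
  ann_chain (extend_layer L s) c = row_mx (ann_chain L c) 0.
Proof.
move=> sK Kc.
pose row0 (x : 'rV['F_2]_(rk L)) : 'rV['F_2]_(rk L + 1) := row_mx x 0.
have row0D : {morph row0 : x y / x + y} by move=> x y;
  rewrite /row0 add_row_mx addr0.
rewrite -/(row0 _) (big_morph row0 row0D (row_mx0 _ _ _ _)).
apply: eq_bigr => t _; rewrite /row0 /=; case: eqP => [-> | _].
  by rewrite (chains_out Kc) ?mem_simplices ?(negPf sK) // !scale0r row_mx0.
by rewrite -[in RHS](scaler0 _ (c t)) scale_row_mx.
Qed.

(** Every cycle [z] of the larger complex is a cycle of [K] plus [z s] times [e], and the new entry
    reads off [z s]. Boundaries in this dimension do not change. *)
Lemma extend_annotates K s L e : s \notin K ->
  simplicial_complex K ->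
  e \in cycles (s |: K) (sdim s) -> e s = 1 ->
  annotates K (sdim s) L ->
  annotates (s |: K) (sdim s) (extend_layer L s).
Proof.
move=> sK cK Ze es [ker surj].
have [K'e /eqP de] : e \in chains (s |: K) (sdim s) /\ boundary e == 0.
  by apply/andP; rewrite -mem_cycles.
set c := e - schain s.
have Kc : c \in chains K (sdim s).
  by have := chains_insert K'e; rewrite es scale1r.
have ann_e : ann_chain (extend_layer L s) e = row_mx (ann_chain L c) (const_mx
  1).
  rewrite -(subrK (schain s) e) ann_chainD -/c (ann_chain_extend _ sK Kc).
  by rewrite ann_schain /= eqxx add_row_mx addr0 add0r.
have K'K : {subset K <= s |: K} by move=> t tK; rewrite inE tK orbT.
have decomp z : z \in cycles (s |: K) (sdim s) -> z - z s *:
  e \in cycles K (sdim s).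
  rewrite !mem_cycles => /andP[K'z /eqP dz].
  rewrite boundaryB boundaryZ dz de scaler0 subr0 eqxx andbT.
  rewrite -(subrK (schain s) e) scalerDr opprD addrA addrAC -/c.
  by rewrite memvB ?chains_insert ?memvZ.
have eqB : boundaries (s |: K) (sdim s) = boundaries K (sdim s).
  by rewrite /boundaries /chains simplices_insert_neq // neq_ltn ltnSn orbT.
split=> [z Zz | x].
  rewrite eqB; split=> [ann0 | Bz]; last first.
    have Zz' : z \in cycles K (sdim s).
      by case/mem_boundariesP: Bz => d Kd ->; apply: boundary_cycle.
    have Kz : z \in chains K (sdim s) by case/memv_capP: Zz'.
    by rewrite (ann_chain_extend _ sK Kz) (_ : ann_chain L z = 0) ?row_mx0 //;
      apply/ker.
  have Zz0 := decomp z Zz; set z0 := z - _ in Zz0.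
  have Kz0 : z0 \in chains K (sdim s) by case/memv_capP: Zz0.
  have zE : z = z0 + z s *: e by rewrite subrK.
  have : ann_chain (extend_layer L s) z =
      row_mx (ann_chain L z0 + z s *: ann_chain L c) (z s *: const_mx 1).
    rewrite {1}zE ann_chainD ann_chainZ ann_e (ann_chain_extend _ sK Kz0).
    by rewrite scale_row_mx add_row_mx add0r.
  rewrite ann0 -row_mx0 => /esym/eq_row_mx[annz0 /rowP/(_ 0)].
  rewrite !mxE mulr1 => zs0.
  by move: zE; rewrite zs0 scale0r addr0 => ->; apply/ker => //;
    rewrite -annz0 zs0 scale0r addr0.
pose l : ('F_2)^o := rsubmx x 0 0.
(* The old entries of [e] equal the annotation of [c], which may be nonzero and is subtracted
   beforehand. *)
have [z0 Zz0 annz0] := surj (lsubmx x - l *: ann_chain L c).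
have Kz0 : z0 \in chains K (sdim s) by case/memv_capP: Zz0.
exists (z0 + l *: e).
  rewrite memvD ?memvZ //; move: Zz0; rewrite !mem_cycles => /andP[_ ->].
  by rewrite (chains_sub K'K).
rewrite ann_chainD ann_chainZ ann_e (ann_chain_extend _ sK Kz0) annz0.
rewrite scale_row_mx add_row_mx add0r subrK -[RHS]hsubmxK; congr row_mx.
by apply/rowP => i; rewrite !ord1 mxE [const_mx _ _ _]mxE mulr1.
Qed.

(** Over the field with two elements, adding [b] exactly when the entry at [w] is nonzero means
    adding that entry times [b]; hence the update is linear. *)
Lemma ann_chain_cut L b w c :
  ann_chain (cut_layer (L := L) b w) c =
  col' w (ann_chain L c + ann_chain L c 0 w *: b).
Proof.
pose cut (x : 'rV['F_2]_(rk L)) := col' w (x + x 0 w *: b).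
have cutD : {morph cut : x y / x + y}.
  move=> x y; apply/rowP => j; rewrite !mxE mulrDl addrACA //.
have cut0 : cut 0 = 0 by apply/rowP => j; rewrite !mxE mul0r addr0.
rewrite -/(cut _) (big_morph cut cutD cut0).
apply: eq_bigr => t _ /=; apply/rowP => j; rewrite !mxE -mulrA -mulrDr.
by case: (F2_cases (vec L t 0 w)) => ->;
  rewrite ?eqxx ?oner_eq0 ?mul0r ?mul1r ?mxE.
Qed.

(** Cycles of dimension [q] stay the same, while boundaries gain the boundary of [s]. Since [b] has
    entry 1 at [w], the linear update has kernel spanned by [b]. *)
Lemma cut_annotates K s q L w : sdim s = q.+1 ->
  simplicial_complex K -> simplicial_complex (s |: K) ->
  ann_chain L (boundary (schain s)) 0 w = 1 ->
  annotates K q L ->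
  annotates (s |: K) q (cut_layer (ann_chain L (boundary (schain s))) w).
Proof.
move=> sq cK cK'; set b := ann_chain L _ => bw [ker surj].
have Zs := schain_boundary_cycle sq cK'.
have simplE : simplices (s |: K) q = simplices K q.
  by apply: simplices_insert_neq; rewrite sq neq_ltn ltnSn.
have eqZ : cycles (s |: K) q = cycles K q by rewrite /cycles /chains simplE.
have K'K : {subset K <= s |: K} by move=> t tK; rewrite inE tK orbT.
split=> [z | x]; rewrite ?eqZ; last first.
  (* The preimage of [x] gets the entry 0 at [w], so that the update adds nothing to it before the
     cut. *)
  have [z Zz annz] := surj (\row_j if unlift w j is Some k then x 0 k else 0).
  exists z; rewrite // ann_chain_cut annz; apply/rowP => j.
  by rewrite !mxE unlift_none mul0r addr0 liftK.
move=> Zz; rewrite ann_chain_cut; split=> [/rowP cut0 | ].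
  (* Away from [w] this is the vanishing of the cut vector, and at [w] it holds because [b] has
     entry 1 there. *)
  have ann_z : ann_chain L z = ann_chain L z 0 w *: b.
    apply/rowP => j; rewrite [RHS]mxE; case: (unliftP w j) => [k -> | ->].
      have := cut0 k; rewrite !mxE => /eqP; rewrite addr_eq0 => /eqP ->.
      by rewrite F2_oppr.
    by rewrite bw mulr1.
  set l := ann_chain L z 0 w in ann_z.
  have Zz' : z - l *: boundary (schain s) \in cycles K q
    by rewrite memvB ?memvZ.
  have /(ker _ Zz') /mem_boundariesP[c Kc dc] : ann_chain L (z - l *:
    boundary (schain s)) = 0.
    by rewrite ann_chainB ann_chainZ -ann_z subrr.
  apply/mem_boundariesP; exists (c + l *: schain s).
    rewrite -sq in Kc *; apply: memvD (chains_sub K'K Kc) _.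
    exact: memvZ (schain_chains_insert K s).
  by rewrite boundaryD boundaryZ -dc subrK.
case/mem_boundariesP => c; rewrite -sq => K'c ->.
have Kc := chains_insert K'c; set c0 := c - _ in Kc; rewrite sq in Kc.
rewrite -(subrK (c s *: schain s) c) -/c0 boundaryD boundaryZ.
have -> : ann_chain L (boundary c0 + c s *: boundary (schain s)) = c s *: b.
  rewrite ann_chainD ann_chainZ (_ : ann_chain L _ = 0) ?add0r //.
  by apply/ker; [apply: boundary_cycle | apply/mem_boundariesP; exists c0].
by rewrite !mxE bw mulr1 F2_rV_addrr; apply/rowP => j; rewrite !mxE.
Qed.

(** No cycle passes through [s]: the rest of such a cycle would be a chain of [K] with the same
    boundary as [s], which would then have zero annotation. *)
Lemma zero_annotates K s q L L0 : sdim s = q.+1 -> s \notin K ->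
  simplicial_complex K -> simplicial_complex (s |: K) ->
  ann_chain L0 (boundary (schain s)) != 0 ->
  annotates K q L0 -> annotates K (sdim s) L ->
  annotates (s |: K) (sdim s) (zero_layer L s).
Proof.
move=> sq sK cK cK' b0 [ker0 _]; rewrite sq => annL.
have eqZ : cycles (s |: K) q.+1 = cycles K q.+1.
  apply/vspaceP => z; rewrite !mem_cycles; apply/andP/andP => -[Kz dz];
    split=> //; last first.
    by apply: chains_sub Kz => t tK; rewrite inE tK orbT.
  move: Kz; rewrite -sq => /chains_insert; case: (F2_cases (z s)) => ->.
    by rewrite scale0r subr0.
  rewrite scale1r => Kz; case/negP: b0; apply/eqP/ker0.
    exact: schain_boundary_cycle.
  apply/mem_boundariesP; exists (z - schain s); first by rewrite -sq.
  by rewrite boundaryB (eqP dz) add0r; apply/eqP;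
    rewrite -addr_eq0 F2_chain_addrr.
have eqB : boundaries (s |: K) q.+1 = boundaries K q.+1.
  by rewrite /boundaries /chains simplices_insert_neq // sq neq_ltn ltnSn orbT.
have : annotates (s |: K) q.+1 L by rewrite /annotates eqZ eqB.
case: L {annL} => n vL; apply: annotates_eq_rk => z;
  rewrite eqZ => /memv_capP[Kz _].
apply: (eq_ann_chain _ Kz) => t; rewrite mem_simplices => /andP[tK _] /=.
by case: eqP => // ts; rewrite -ts tK in sK.
Qed.

Lemma last_nonzero_some n (x : 'rV['F_2]_n) w :
  last_nonzero x = Some w -> x 0 w = 1.
Proof.
rewrite /last_nonzero; case: pickP => // w' /andP[xw _] [<-].
by case: (F2_cases (x 0 w')) xw => -> //; rewrite eqxx.
Qed.

(** Only the dimension of [s] and the one below need attention. If the boundary of [s] bounds some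
    [c] in [K], then [schain s - c] is a new cycle; otherwise a class is killed one dimension
    lower. *)
Lemma insert_annotates K s a : s \notin K ->
  simplicial_complex K -> simplicial_complex (s |: K) ->
  (forall p, annotates K p (a p)) ->
  forall p, annotates (s |: K) p (insert_simplex a s p).
Proof.
move=> sK cK cK' ann; rewrite /insert_simplex.
set b := ann_chain _ _; case lb: (last_nonzero b) => [w|] p.
  have bw := last_nonzero_some lb.
  have bn0 : b != 0 by apply/eqP => b0; rewrite b0 mxE in bw.
  (* A vertex has zero boundary, so a nonzero [b] forces positive dimension and the truncated
     predecessor is genuine. *)
  have sq : sdim s = (sdim s).-1.+1.
    rewrite prednK // lt0n; apply: contraNneq bn0 => s0; rewrite /b.
    have -> : boundary (schain s) = 0; last by rewrite ann_chain0.
    by apply: (@boundary_chains0 _ (s |: K));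
      have := schain_chains_insert K s; rewrite s0.
  have [-> | ne_pq] := eqVneq p (sdim s).-1; first exact: cut_annotates.
  have [-> | ne_pq1] := eqVneq p (sdim s);
    first exact: (zero_annotates sq sK cK cK' bn0).
  apply: eq_annotates (ann p); first by rewrite simplices_insert_neq.
  by rewrite /boundaries /chains simplices_insert_neq // sq eqSS.
have /eqP b0 : b == 0 by rewrite -last_nonzeroE lb.
have [c Kc dc] : exists2 c, c \in chains K (sdim s) & boundary c = boundary
  (schain s).
  move: b0; rewrite /b {b lb}; case sq: (sdim s) => [|q] /= b0.
    exists 0; rewrite ?mem0v // boundary0;
      apply/esym/(@boundary_chains0 _ (s |: K)).
    by have := schain_chains_insert K s; rewrite sq.
  have Zs := schain_boundary_cycle sq cK'.
  have /mem_boundariesP[c Kc ->] : boundary (schain s) \in boundaries K q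
    by exact: (proj1 (proj1 (ann q) _ Zs) b0).
  by exists c.
have K'K : {subset K <= s |: K} by move=> t tK; rewrite inE tK orbT.
have cs : c s = 0 by apply: (chains_out Kc); rewrite mem_simplices (negPf sK).
have Ze : schain s - c \in cycles (s |: K) (sdim s).
  rewrite mem_cycles boundaryB dc subrr eqxx andbT.
  exact: memvB (schain_chains_insert K s) (chains_sub K'K Kc).
have es : (schain s - c) s = 1.
  by rewrite chain_subE cs schainE eqxx subr0.
have [-> | ne_ps] := eqVneq p (sdim s);
  first exact: (extend_annotates sK cK Ze es).
apply: eq_annotates (ann p); first by rewrite simplices_insert_neq.
have [eps | ne_p1s] := eqVneq p.+1 (sdim s); last first.
  by rewrite /boundaries /chains simplices_insert_neq.
apply/vspaceP => z; apply/mem_boundariesP/mem_boundariesP;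
  rewrite eps => -[d Kd ->].
  by exists d; rewrite ?(chains_sub K'K).
(* Subtracting a multiple of the cycle [schain s - c] removes [s] from [d] without changing its
   boundary, so no new boundaries appear. *)
exists (d - d s *: (schain s - c)).
  by rewrite scalerBr opprB addrCA memvD ?memvZ ?chains_insert.
move: Ze; rewrite mem_cycles => /andP[_ /eqP de].
by rewrite boundaryB boundaryZ de scaler0 subr0.
Qed.

(** The order by dimension ensures that every intermediate set of simplices is again a complex. *)
Lemma inserts_annotates K (ss : seq {set V}) a :
  uniq ss -> {in ss, forall s, s \notin K} ->
  sorted (fun s t => sdim s <= sdim t)%N ss ->
  simplicial_complex K -> simplicial_complex (K :|: [set:: ss]) ->
  (forall p, annotates K p (a p)) ->
  forall p, annotates (K :|: [set:: ss]) p (foldl (@insert_simplex V) a ss p).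
Proof.
elim: ss K a => [|s ss IHss] K a /=.
  by move=> _ _ _ _ _ ann p; rewrite (_ : [set:: [::]] = set0) ?setU0 //;
    apply/setP => t; rewrite !inE.
move=> /andP[s_ss uniq_ss] ssK sorted_ss cK cK'.
have le_s : {in s :: ss, forall t, sdim s <= sdim t}%N.
  move: sorted_ss; rewrite (path_sortedE (leT := fun s t => (sdim s <= sdim
    t)%N)); last first.
    by move=> x y z; apply: leq_trans.
  by case/andP => /allP le_s _ t; rewrite inE => /predU1P[-> //|/le_s].
have eqU : K :|: [set:: s :: ss] = (s |: K) :|: [set:: ss].
  by apply/setP => t; rewrite !inE orbCA orbA.
(* A proper face of [s] lies in the final complex and has smaller dimension than everything in
   [s :: ss], so it is already in [K]. *)
have cK1 : simplicial_complex (s |: K).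
  split=> [|r t]; first by case: cK' => + _; apply: contra => K10;
    rewrite eqU inE K10.
  move=> K1r tr t0; have Kt : t \in K :|: [set:: s :: ss].
    by apply: (proj2 cK' r) => //; rewrite eqU inE K1r.
  move: K1r; rewrite !inE => /predU1P[ers | Kr]; last first.
    by rewrite (proj2 cK r t) ?orbT.
  move: Kt; rewrite !inE orbCA; have [// | ne_ts /=] := eqVneq t s.
  case/orP => // /(mem_behead (s := s :: ss)) /le_s; rewrite leqNgt => /negP[].
  rewrite /sdim -ltnS !prednK ?card_gt0 //; last first.
    by apply: contraNneq t0 => s0; rewrite -subset0 -s0 -ers.
  by apply: proper_card; rewrite properEneq ne_ts -ers.
move=> ann p; rewrite eqU; apply: IHss => //.
- move=> t t_ss; rewrite !inE negb_or ssK ?inE ?t_ss ?orbT // andbT.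
  by apply: contraNneq s_ss => <-.
- exact: path_sorted sorted_ss.
- by rewrite -eqU.
by apply: insert_annotates => //; apply: ssK; rewrite inE eqxx.
Qed.

End Insertion.

(** * The induced chain map *)

Section PushForward.
Variables (V : finType) (f : V -> V).
Implicit Types (K : {set {set V}}) (r s t : {set V}) (p : nat).
Implicit Types (c z : chain V) (L : layer V).

(** The usual chain map induced by [f]: comparing cardinalities discards the simplices on which [f]
    is not injective. *)
Definition pushc c : chain V :=
  [ffun t => \sum_(s : {set V} | (f @: s == t) && (#|s| == #|t|)) c s].

Lemma pushc_is_linear : linear pushc.
Proof.
move=> k c1 c2; apply/ffunP => t; rewrite chain_addE chain_scaleE !ffunE.
rewrite mulr_sumr -big_split /=; apply: eq_bigr => s _.
by rewrite chain_addE chain_scaleE.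
Qed.

HB.instance Definition _ :=
  GRing.isLinear.Build _ _ _ _ pushc pushc_is_linear.

Lemma pushc_schain s : #|f @: s| = #|s| -> pushc (schain s) = schain (f @: s).
Proof.
move=> card_fs; apply/ffunP => t; rewrite ffunE schainE big_mkcond /=.
rewrite (bigD1 s) //= big1 ?addr0 => [|r ne_rs]; last first.
  by rewrite schainE (negPf ne_rs) if_same.
rewrite schainE eqxx -card_fs eq_sym; case: (t =P f @: s) => [<-|_] //=.
by rewrite eqxx.
Qed.

(** Support without a fixed dimension, which also covers the boundary of a 0-chain. *)
Definition supported c K := forall s, s \notin K -> c s = 0.

Lemma chains_supported K p c : c \in chains K p -> supported c K.
Proof.
by move=> Kc s sK; apply: (chains_out Kc); rewrite mem_simplices (negPf sK).
Qed.

Lemma boundary_supported K c :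
  simplicial_complex K -> supported c K -> supported (boundary c) K.
Proof.
move=> [_ Kcl] c0 t tK; rewrite ffunE big1 // => s /and3P[t0 ts _].
by apply: c0; apply: contra tK => sK; apply: Kcl sK _ _.
Qed.

Lemma pushc_chains K K' p c : simplicial_map f K K' ->
  c \in chains K p -> pushc c \in chains K' p.
Proof.
move=> fK Kc; apply/mem_chainsP => t tK'; rewrite ffunE big1 // => s.
move=> /andP[/eqP fs /eqP cs]; apply: (chains_out Kc); apply: contra tK'.
by rewrite !mem_simplices /sdim cs => /andP[/fK]; rewrite fs => -> ->.
Qed.

(* If [f] identifies two vertices of [s] but not of [s :\ x], then [s] has
   exactly two facets mapped onto [f @: s], and they cancel. *)
Lemma card_facets_over c t s :
  \sum_(r : {set V} | (f @: r == t) && (#|r| == #|t|) && facet r s) c s =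
  if facet t (f @: s) && (#|s| == #|f @: s|) then c s else 0.
Proof.
pose A (r : {set V}) := (f @: r == t) && (#|r| == #|t|) && facet r s.
rewrite sumr_const -[X in _ *+ X]/#|A|; set n := #|A|.
case: ifP => [/andP[/and3P[t0 tfs /eqP cfs] /eqP cs] | notB].
  have f_inj : {in s &, injective f} by apply/imset_injP; rewrite -cs.
  suff -> : n = 1%N by [].
  (* When [f] is injective on [s], the only facet over [t] consists of the vertices of [s] mapped
     into [t]. *)
  pose r0 := s :&: f @^-1: t.
  have fr0 : f @: r0 = t.
    apply/setP => y; apply/imsetP/idP => [[x] | ty].
      by rewrite !inE => /andP[_ tx] ->.
    have /imsetP[x sx yE] := subsetP tfs y ty.
    by exists x; rewrite // !inE sx -yE.
  have cr0 : #|r0| = #|t|.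
    rewrite -fr0 card_in_imset // => x y /setIP[sx _] /setIP[sy _].
    exact: f_inj.
  rewrite /n -(card1 r0); apply: eq_card => r; rewrite unfold_in [in RHS]inE.
  apply/idP/eqP => [/andP[/andP[/eqP fr _] /and3P[_ rs _]] | ->].
    apply/setP => x; rewrite !inE; apply/idP/andP => [rx | [sx]].
      by rewrite (subsetP rs) // -fr imset_f.
    rewrite -fr => /imsetP[y ry fxy].
    by rewrite (f_inj x y) // (subsetP rs).
  rewrite /A fr0 cr0 !eqxx /= /facet subsetIl cs cfs cr0 eqxx !andbT.
  by rewrite -card_gt0 cr0 card_gt0 t0.
have [r0 | n0] := pickP A; last by rewrite /n (eq_card0 n0).
move=> /andP[/andP[/eqP fr0 /eqP cr0] /and3P[r00 r0s /eqP cs]].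
have /cards1P[x sx] : #|s :\: r0| == 1%N.
  by rewrite cardsD (setIidPr r0s) cs subSnn.
have [xr0 xs] : x \notin r0 /\ x \in s.
  by apply/andP; rewrite -in_setD sx !inE eqxx.
have sE : s = x |: r0 by rewrite -sx setUC -[LHS](setID s r0) (setIidPr r0s).
have fsE : f @: s = f x |: t by rewrite sE imsetU1 fr0.
have t0 : t != set0 by rewrite -card_gt0 -cr0 card_gt0.
(* Otherwise [f] would be injective on [s] and [t] a facet of the image, contrary to [notB]. *)
have fxt : f x \in t.
  apply: contraFT notB => fxt; rewrite /facet fsE subsetUr t0 cardsU1 fxt.
  by rewrite cs cr0 !eqxx.
have fst : f @: s = t by rewrite fsE; apply/setUidPr; rewrite sub1set.
move: (fxt); rewrite -{1}fr0 => /imsetP[y yr0 fxy].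
have ne_xy : x != y by apply: contraNneq xr0 => ->.
suff -> : n = 2%N by rewrite mulr2n F2_addrr.
have ys : y \in s by apply: (subsetP r0s).
have ne_sxy : s :\ x != s :\ y.
  apply/eqP => /setP/(_ x); rewrite !inE eqxx ne_xy xs //.
rewrite -[RHS](_ : #|[set s :\ x; s :\ y]| = 2%N);
  last by rewrite cards2 ne_sxy.
have card_del w0 : w0 \in s -> #|s :\ w0| = #|t|.
  by move=> w0s; move: cs; rewrite (cardsD1 w0) w0s add1n cr0 => -[].
have f_del w0 w1 : w1 \in s -> w1 != w0 -> f w0 = f w1 -> w0 \in s ->
    f @: (s :\ w0) = t.
  move=> w1s ne fz w0s; rewrite -fst -{2}(setD1K w0s) imsetU1;
    apply/esym/setUidPr.
  by rewrite sub1set fz imset_f // !inE ne.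
have main w0 w1 : w0 \in s -> w1 \in s -> w1 != w0 -> f w0 = f w1 ->
    A (s :\ w0).
  move=> w0s w1s ne fz; rewrite /A (f_del w0 w1) // card_del // !eqxx /=.
  rewrite /facet subsetDl card_del // cs cr0 eqxx !andbT.
  by apply/set0Pn; exists w1; rewrite !inE ne.
apply: eq_card => r; rewrite unfold_in !inE; apply/idP/orP; last first.
  by case=> /eqP ->; [apply: (main x y) | apply: (main y x)]; rewrite // eq_sym.
move=> /andP[/andP[/eqP fr /eqP cr] /and3P[_ rs /eqP csr]].
(* Being injective on a facet [r] over [t], the map [f] cannot have both [x] and [y] in [r], so [r]
   omits one of them. *)
have f_inj : {in r &, injective f} by apply/imset_injP; rewrite fr cr.
have /cards1P[x1 sx1] : #|s :\: r| == 1%N.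
  by rewrite cardsD (setIidPr rs) csr subSnn.
have rE : r = s :\ x1 by rewrite -sx1 setDDr setDv set0U (setIidPr rs).
have [ex | nx] := eqVneq x1 x; first by left; rewrite rE ex.
have [ey | ny] := eqVneq x1 y; first by right; rewrite rE ey.
case/eqP: ne_xy; apply: f_inj; rewrite // rE !inE ?xs ?ys eq_sym.
  by rewrite nx.
by rewrite ny.
Qed.

(** In the coefficient of the right side at [t], each [s] is counted once for every facet mapped
    bijectively onto [t]. By [card_facets_over] this count is odd exactly when [f] is injective on
    [s] and [t] is a facet of its image. *)
Lemma boundary_pushc c : boundary (pushc c) = pushc (boundary c).
Proof.
apply/ffunP => t; rewrite !ffunE.
under eq_bigr do rewrite ffunE.
under [RHS]eq_bigr do rewrite ffunE.
rewrite [RHS](exchange_big_dep predT) //=.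
under [RHS]eq_bigr do rewrite card_facets_over.
rewrite -big_mkcond /=.
rewrite [RHS](partition_big (fun s => f @: s) (fun t' => facet t t'));
  last first.
  by move=> s /andP[].
apply: eq_bigr => t' tt'; apply: eq_bigl => s.
by case: eqP => [-> | _]; rewrite ?tt' ?andbT ?andbF.
Qed.

(** One preimage of equal size is chosen for each simplex of [K']. The lift of a cycle obtained this
    way need not be a cycle. *)
Lemma pushc_lift K K' p c' :
  (forall t, t \in K' -> exists2 s, s \in K & #|s| = #|t| /\ f @: s = t) ->
  c' \in chains K' p -> exists2 c, c \in chains K p & pushc c = c'.
Proof.
move=> f_surj K'c'.
have lift t : exists s, t \in simplices K' p ->
    [/\ s \in simplices K p, #|f @: s| = #|s| & f @: s = t].
  have [tK' | tK'] := boolP (t \in simplices K' p); last by exists set0.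
  move: tK'; rewrite mem_simplices => /andP[tK' tp].
  by have [s sK [cs fs]] := f_surj t tK'; exists s;
    rewrite mem_simplices sK /sdim cs tp fs.
have [g gP] := fin_all_exists lift.
exists (\sum_(t in simplices K' p) c' t *: schain (g t)).
  by apply: memv_suml => t /gP[gK _ _]; apply: memvZ; apply: schain_chains.
rewrite linear_sum [RHS]chain_sum [RHS](bigID (mem (simplices K' p))) /=.
rewrite [X in _ = _ + X]big1 ?addr0 => [|t /(chains_out K'c') ->];
  last exact: scale0r.
by apply: eq_bigr => t /gP[_ cg gt];
  rewrite [LHS]linearZ /= (pushc_schain cg) gt.
Qed.

Section Annotation.
Variables (K K' : {set {set V}}) (p : nat) (L : layer V).
Hypothesis cK : simplicial_complex K.
Hypothesis fK : simplicial_map f K K'.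
Hypothesis f_surj :
  forall t, t \in K' -> exists2 s, s \in K & #|s| = #|t| /\ f @: s = t.
Hypothesis lift_cycles :
  forall z', z' \in cycles K' p -> exists2 z, z \in cycles K p & pushc z = z'.
Hypothesis vec_collapsed :
  forall s, s \in simplices K p -> #|f @: s| != #|s| -> vec L s = 0.
Hypothesis vec_fiber :
  forall r s, r \in simplices K p -> s \in simplices K p ->
    #|f @: r| = #|r| -> #|f @: s| = #|s| -> f @: r = f @:
      s -> vec L r = vec L s.

(** Simplices are grouped by their image: those that lose dimension have zero annotation, and those
    with a common image have equal vectors, so the choice made by [push_layer] is harmless. *)
Lemma ann_chain_pushc c : c \in chains K p ->
  ann_chain (push_layer f K L) (pushc c) = ann_chain L c.
Proof.
move=> Kc; rewrite /ann_chain.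
have vecE s : s \in simplices K p -> #|f @: s| = #|s| ->
    vec (push_layer f K L) (f @: s) = vec L s.
  rewrite mem_simplices => /andP[Ks ps] cfs; rewrite /push_layer /=.
  case: pickP => [r /and3P[Kr /eqP cr /eqP fr] | /(_ s)]; last first.
    by rewrite Ks cfs !eqxx.
  by apply: vec_fiber; rewrite ?mem_simplices ?Kr ?Ks ?ps // /sdim ?cr ?cfs ?fr.
transitivity (\sum_(s : {set V} | #|s| == #|f @: s|)
                 c s *: vec (push_layer f K L) (f @: s)).
  rewrite [RHS](partition_big (fun s => f @: s) predT) //.
  apply: eq_bigr => t _; rewrite ffunE scaler_suml; apply: eq_big => s.
    by rewrite [RHS]andbC; case: eqP => [<- | _].
  by move=> /andP[/eqP -> _].
rewrite [RHS](bigID (fun s : {set V} => #|s| == #|f @: s|)) /=.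
rewrite [X in _ = _ + X]big1 ?addr0 => [|s ncs].
  apply: eq_bigr => s /eqP cs.
  have [Ks | Ks] := boolP (s \in simplices K p).
    by congr (_ *: _); apply: vecE.
  by rewrite (chains_out Kc Ks) !scale0r.
have [Ks | Ks] := boolP (s \in simplices K p).
  by rewrite vec_collapsed ?scaler0 // eq_sym.
by rewrite (chains_out Kc Ks) scale0r.
Qed.

(** A cycle with zero annotation lifts to a cycle that bounds in [K], and the bounding chain is
    pushed forward. Conversely, a bounding chain in [K'] lifts to [K]. *)
Lemma push_annotates : annotates K p L -> annotates K' p (push_layer f K L).
Proof.
move=> [ker surj].
have push_cycles z : z \in cycles K p -> pushc z \in cycles K' p.
  rewrite !mem_cycles => /andP[Kz /eqP dz].
  by rewrite (pushc_chains fK Kz) boundary_pushc dz [pushc 0]linear0 eqxx.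
split=> [z' Zz' | x]; last first.
  have [z Zz <-] := surj x; exists (pushc z); first exact: push_cycles.
  by apply: ann_chain_pushc; case/memv_capP: Zz.
split=> [ann0 | /mem_boundariesP[c' K'c' ->]].
  have [z Zz zz'] := lift_cycles Zz'.
  have Kz : z \in chains K p by case/memv_capP: Zz.
  move: ann0; rewrite -zz' ann_chain_pushc // => /(ker z Zz).
  move=> /mem_boundariesP[c Kc ->]; apply/mem_boundariesP.
  by exists (pushc c); rewrite ?boundary_pushc ?(pushc_chains fK Kc).
have [c Kc <-] := pushc_lift f_surj K'c'.
rewrite boundary_pushc ann_chain_pushc; last exact: boundary_chains.
apply/ker; first exact: boundary_cycle.
by apply/mem_boundariesP; exists c.
Qed.

End Annotation.
End PushForward.

(** * Renaming of vertices *)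

Section Inclusion.
Variables (V : finType) (f : V -> V) (K : {set {set V}}).
Hypothesis cK : simplicial_complex K.
Hypothesis f_inj : {in [pred x | [set x] \in K] &, injective f}.

Lemma vertex_in (s : {set V}) x : s \in K -> x \in s -> [set x] \in K.
Proof.
move=> Ks xs; apply: (proj2 cK s) => //; first by rewrite sub1set.
by apply/set0Pn; exists x; rewrite inE.
Qed.

Lemma imset_inj_complex : {in K &, injective (fun s : {set V} => f @: s)}.
Proof.
have sub (r s : {set V}) : r \in K -> s \in K -> f @: r = f @: s -> r \subset s.
  move=> Kr Ks frs; apply/subsetP => x xr.
  have : f x \in f @: s by rewrite -frs imset_f.
  case/imsetP => y ys fxy; rewrite (f_inj _ _ fxy) // inE.
    exact: vertex_in Kr xr.
  exact: vertex_in Ks ys.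
by move=> r s Kr Ks frs; apply/eqP; rewrite eqEsubset !sub.
Qed.

Lemma card_imset_complex (s : {set V}) : s \in K -> #|f @: s| = #|s|.
Proof.
move=> Ks; apply: card_in_imset => x y xs ys; apply: f_inj.
  exact: vertex_in Ks xs.
exact: vertex_in Ks ys.
Qed.

Lemma pushc_inj_complex (c : chain V) :
  supported c K -> pushc f c = 0 -> c = 0.
Proof.
move=> c0 fc; apply/ffunP => s; rewrite [RHS]ffunE.
have [Ks | /c0 //] := boolP (s \in K).
have /ffunP/(_ (f @: s)) := fc; rewrite !ffunE (bigD1 s) /=; last first.
  by rewrite card_imset_complex ?eqxx.
rewrite big1 ?addr0 // => r /andP[/andP[/eqP frs _] ne_rs].
by apply: c0; apply: contra ne_rs => Kr; apply/eqP/imset_inj_complex.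
Qed.

Lemma map_complex_simplicial : simplicial_complex (map_complex f K).
Proof.
split=> [|t t' /imsetP[s Ks ->] t's t'0].
  apply/imsetP => -[s Ks /esym/eqP]; rewrite -cards_eq0 card_imset_complex //.
  by rewrite cards_eq0 => /eqP s0; move: Ks; rewrite s0 (negPf (proj1 cK)).
have ft' : f @: (s :&: f @^-1: t') = t'.
  apply/setP => y; apply/imsetP/idP => [[x] | ty].
    by rewrite !inE => /andP[_ tx] ->.
  have /imsetP[x sx yE] := subsetP t's y ty.
  by exists x; rewrite // !inE sx -yE.
apply/imsetP; exists (s :&: f @^-1: t'); rewrite ?ft' //.
apply: (proj2 cK s) => //; first exact: subsetIl.
by apply: contraNneq t'0 => e; rewrite -ft' e imset0.
Qed.

Lemma map_annotates (a : annotation V) :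
  (forall p, annotates K p (a p)) ->
  forall p, annotates (map_complex f K) p (push_annotation f K a p).
Proof.
move=> ann p.
have surj t : t \in map_complex f K ->
    exists2 s, s \in K & #|s| = #|t| /\ f @: s = t.
  by case/imsetP => s Ks ->; exists s; rewrite // card_imset_complex.
apply: push_annotates (ann p) => //; first by move=> s Ks; apply: imset_f.
- move=> z'; rewrite mem_cycles => /andP[K'z' /eqP dz'].
  have [z Kz fz] := pushc_lift surj K'z'; exists z; rewrite // mem_cycles Kz /=.
  (* The boundary of the lift is mapped to 0, and the chain map is injective on chains supported in
     [K]. *)
  apply/eqP/pushc_inj_complex; last by rewrite -boundary_pushc fz.
  exact: boundary_supported cK (chains_supported Kz).
- by move=> s; rewrite mem_simplices => /andP[Ks _];
    rewrite card_imset_complex ?eqxx.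
move=> r s; rewrite !mem_simplices => /andP[Kr _] /andP[Ks _] _ _.
by move/imset_inj_complex => ->.
Qed.

End Inclusion.

(** * Annotation transfer *)

Section Transfer.
Variables (V : finType) (K : {set {set V}}) (u v : V).
Hypothesis ne_uv : u != v.
Implicit Types (s t : {set V}) (a : annotation V).

Lemma transfer_vec_self s a : s \in vanishing_simplices K u v ->
  vec (transfer K v a s (sdim s)) s = 0.
Proof.
rewrite inE => /andP[Ks _]; rewrite /transfer eqxx /=.
by rewrite mem_simplices Ks eqxx subsetDl F2_rV_addrr.
Qed.

(** A vanishing simplex that contains [s :\ v] contains all of [s]; in equal dimension it is [s]
    itself. So a transfer does not touch the other vanishing simplices. *)
Lemma transfer_vec_other s t a : s \in vanishing_simplices K u v ->
  t \in vanishing_simplices K u v -> vec (a (sdim t)) t = 0 ->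
  vec (transfer K v a s (sdim t)) t = 0.
Proof.
have [-> Kt _ _ | ne_ts] := eqVneq t s; first exact: transfer_vec_self.
rewrite !inE => /and3P[Ks us vs] /and3P[Kt ut vt] at0; rewrite /transfer.
case: eqP => // st /=; rewrite ifN //; apply: contra ne_ts.
case/andP => _ /subsetP st_sub; rewrite eq_sym eqEcard.
apply/andP; split.
  by apply/subsetP => x xs; have [-> //| nx] := eqVneq x v; apply: st_sub;
    rewrite !inE nx.
by rewrite (card_sdim ut) (card_sdim us) st.
Qed.

(** The disjunction is the invariant: a vanishing simplex is still to be processed or already has
    zero annotation. This makes the order of processing arbitrary. *)
Lemma transfers_vec vs t a : {subset vs <= vanishing_simplices K u v} ->
  t \in vanishing_simplices K u v -> t \in vs \/ vec (a (sdim t)) t = 0 ->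
  vec (foldl (transfer K v) a vs (sdim t)) t = 0.
Proof.
move=> sub_vs Kt; elim: vs a sub_vs => [|s vs IHvs] a sub_vs /=; first by case.
have Ks : s \in vanishing_simplices K u v by apply: sub_vs; rewrite inE eqxx.
move=> at0; apply: IHvs => [r r_vs|]; first by apply: sub_vs;
  rewrite inE r_vs orbT.
case: at0 => [|at0]; last by right; apply: transfer_vec_other.
by rewrite inE => /predU1P[->|]; [right; apply: transfer_vec_self | left].
Qed.

(* [transfer] adds to the annotation a multiple of the coboundary of [s :\ v],
   which vanishes on cycles. *)
Lemma transfer_annotates s a : s \in vanishing_simplices K u v ->
  (forall p, annotates K p (a p)) ->
  forall p, annotates K p (transfer K v a s p).
Proof.
rewrite inE => /and3P[Ks us vs] ann p; rewrite /transfer.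
case: eqP => [-> | _]; last exact: ann.
have := ann (sdim s); case: (a _) => n vL; apply: annotates_eq_rk => z.
rewrite mem_cycles => /andP[Kz /eqP dz]; rewrite /ann_chain /=.
pose near t := (t \in simplices K (sdim s)) && (s :\ v \subset t).
transitivity (\sum_t (z t *: vL t + (if near t then z t else 0) *: vL s));
  last first.
  apply: eq_bigr => t _; rewrite -/(near t).
  by case: ifP; rewrite ?scalerDr // scale0r addr0.
rewrite big_split /= -scaler_suml -big_mkcond /=.
suff -> : \sum_(t | near t) z t = 0 by rewrite scale0r addr0.
have sv0 : s :\ v != set0 by apply/set0Pn; exists u; rewrite !inE ne_uv.
have /ffunP/(_ (s :\ v)) := dz; rewrite !ffunE; apply: etrans.
rewrite [LHS]big_mkcond [RHS]big_mkcond /=; apply: eq_bigr => t _.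
have [Kt | Kt] := boolP (t \in simplices K (sdim s)); last first.
  by rewrite (chains_out Kz Kt) !if_same.
rewrite /near Kt /facet sv0 /=; congr (if _ then _ else _).
have -> : #|s :\ v|.+1 = #|s| by rewrite (cardsD1 v s) vs.
have [svt|//] := boolP (s :\ v \subset t).
move: Kt; rewrite mem_simplices => /andP[Kt /eqP st].
(* Equal values of [sdim] give equal cardinalities only for nonempty sets; the vertex [u] shows that
   both are nonempty. *)
have ut : u \in t by apply: (subsetP svt); rewrite !inE ne_uv.
by rewrite (card_sdim ut) (card_sdim us) st eqxx.
Qed.

Lemma transfers_annotates vs a : {subset vs <= vanishing_simplices K u v} ->
  (forall p, annotates K p (a p)) ->
  forall p, annotates K p (foldl (transfer K v) a vs p).
Proof.
elim: vs a => //= s vs IHvs a sub_vs ann.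
apply: IHvs => [r r_vs|]; first by apply: sub_vs; rewrite inE r_vs orbT.
by apply: transfer_annotates => //; apply: sub_vs; rewrite inE eqxx.
Qed.

End Transfer.

(** * Collapse under the link condition *)

Section Collapse.
Variables (V : finType) (f : V -> V) (K K' : {set {set V}}) (u v : V).
Implicit Types (r s t w : {set V}) (c z k : chain V).
Hypothesis cK : simplicial_complex K.
Hypothesis ne_uv : u != v.
Hypothesis fE : forall x, [set x] \in K -> f x = if x == v then u else x.
(** For empty [w] this puts the edge between [u] and [v] into [K] once both vertices are there. *)
Hypothesis link_condition : forall w, u \notin w -> v \notin w ->
  u |: w \in K -> v |: w \in K -> u |: (v |: w) \in K.

Lemma imset_collapse s : s \in K ->
  f @: s = if v \in s then u |: (s :\ v) else s.
Proof.
move=> Ks.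
have fxE x : x \in s -> f x = if x == v then u else x.
  by move=> xs; apply/fE/(vertex_in cK Ks xs).
have fid w : w \subset s -> v \notin w -> f @: w = w.
  move=> ws vw; rewrite -[RHS]imset_id; apply: eq_in_imset => x xw.
  by rewrite fxE ?(subsetP ws) // ifN //; apply: contraNneq vw => <-.
case: ifP => [vs | /negbT vs]; last exact: fid.
by rewrite -{1}(setD1K vs) imsetU1 fxE // eqxx fid ?subsetDl // !inE eqxx.
Qed.

Lemma card_collapse s : s \in K ->
  (#|f @: s| == #|s|) = ~~ ((u \in s) && (v \in s)).
Proof.
move=> Ks; rewrite imset_collapse //; case: ifP => vs;
  last by rewrite eqxx andbF.
rewrite (cardsD1 v s) vs cardsU1 !inE ne_uv /= andbT eqn_add2r.
by case: (u \in s).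
Qed.

Lemma collapse_fiber r w : r \in K -> u \notin w -> v \notin w ->
  (f @: r == u |: w) && (#|r| == #|u |: w|) = (r == u |: w) || (r == v |: w).
Proof.
move=> Kr uw vw; apply/andP/orP => [[/eqP fr /eqP cr] | [/eqP er | /eqP er]].
- have : #|f @: r| == #|r| by rewrite fr cr.
  rewrite card_collapse // => /nandP uvr; move: fr; rewrite imset_collapse //.
  case: ifP uvr => [vr uvr fr | vr _ ->]; last by left.
  have ur : u \notin r by case: uvr => //; rewrite vr.
  right; rewrite -(setD1K vr); apply/eqP; congr (_ |: _).
  by rewrite -(setU1K (B := r :\ v) (a := u)) ?fr ?setU1K // !inE negb_and ur
    orbT.
- by rewrite imset_collapse // er !inE (negPf vw) (eq_sym v) (negPf ne_uv)
    !eqxx.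
rewrite imset_collapse // er setU11 setU1K // eqxx !cardsU1 uw vw.
by [].
Qed.

(** The mirror simplices are the only ones mapped bijectively onto [u |: w], so their coefficients
    add up to 0. *)
Lemma collapse_mirror c w : supported c K -> pushc f c = 0 ->
  u \notin w -> v \notin w -> c (u |: w) = c (v |: w).
Proof.
move=> c0 /ffunP/(_ (u |: w)); rewrite !ffunE => fc uw vw.
have ne_uvw : u |: w != v |: w.
  apply/eqP => /setP/(_ u); rewrite !inE eqxx (negPf ne_uv) (negPf uw) //.
move: fc; rewrite big_mkcond (bigD1 (u |: w)) //= (bigD1 (v |: w)) //=;
  last by rewrite eq_sym.
rewrite big1 ?addr0 => [|r /andP[ne1 ne2]]; last first.
  have [Kr | /c0 ->] := boolP (r \in K); last by rewrite if_same.
  by rewrite collapse_fiber // (negPf ne1) (negPf ne2).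
have fib r : (r == u |: w) || (r == v |: w) ->
    (if (f @: r == u |: w) && (#|r| == #|u |: w|) then c r else 0) = c r.
  move=> er; have [Kr | /c0 ->] := boolP (r \in K); last by rewrite if_same.
  by rewrite collapse_fiber // er.
rewrite !fib ?eqxx ?orbT // => /eqP; rewrite addr_eq0 => /eqP ->.
exact: F2_oppr.
Qed.

Lemma setD1_split s : u \in s -> v \in s ->
  [/\ u \notin s :\ u :\ v, v \notin s :\ u :\ v,
      s :\ u = v |: (s :\ u :\ v) & s = u |: (v |: (s :\ u :\ v))].
Proof.
move=> us vs; have vsu : v \in s :\ u by rewrite !inE eq_sym ne_uv.
by rewrite !inE !eqxx andbF /= setD1K // setD1K.
Qed.

(** The cone with apex [u] over the part of [k] on simplices that contain [v] but not [u]. *)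
Definition cone k : chain V :=
  [ffun s : {set V} => if (u \in s) && (v \in s) then k (s :\ u) else 0].

(** If [k] is nonzero on [v |: w], it is nonzero on the mirror simplex too; both lie in [K], and the
    link condition supplies their union. *)
Lemma cone_supported k : supported k K -> pushc f k = 0 -> supported (cone k) K.
Proof.
move=> k0 fk s Ks; rewrite ffunE; case: ifP => // /andP[us vs].
have [uw vw suE sE] := setD1_split us vs; set w := s :\ u :\ v in uw vw suE sE.
apply/eqP; apply: contraNT Ks => ks; rewrite sE; apply: link_condition => //.
  apply: contraR ks => /k0 kuw; rewrite suE -collapse_mirror // kuw //.
by rewrite -suE; apply: contraR ks => /k0 ->.
Qed.

Lemma pushc_cone k : supported (cone k) K -> pushc f (cone k) = 0.
Proof.
move=> k0; apply/ffunP => t; rewrite !ffunE big1 // => s /andP[/eqP fs /eqP cs].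
have [Ks | /k0 //] := boolP (s \in K).
rewrite ffunE ifN //; rewrite -card_collapse // fs cs //.
Qed.

(** The only simplex with facet [v |: w] that contains both [u] and [v] is obtained by adding
    [u]. *)
Lemma boundary_cone_mirror k w : u \notin w -> v \notin w ->
  boundary (cone k) (v |: w) = k (v |: w).
Proof.
move=> uw vw; rewrite ffunE.
have uvw : u \notin v |: w by rewrite !inE (negPf ne_uv).
rewrite (bigD1 (u |: (v |: w))) /=; last first.
  rewrite /facet subsetUr cardsU1 uvw eqxx andbT.
  by apply/andP; split=> //; apply/set0Pn; exists v; rewrite setU11.
rewrite big1 ?addr0 => [|s /andP[/and3P[_ ws /eqP cs] ne_s]].
  by rewrite ffunE !inE !eqxx orbT setU1K.
rewrite ffunE; case: ifP => // /andP[us vs]; case/eqP: ne_s.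
by apply/esym/eqP; rewrite eqEcard subUset sub1set us ws cs (cardsU1 u) uvw
  add1n leqnn.
Qed.

(* A collapsed cycle with no simplex [v |: w] has no mirror simplex [u |: w]
   either, and then the coefficient of [s :\ v] in its boundary is that of
     [s]. *)
Lemma collapsed_cycle_eq0 d : supported d K -> pushc f d = 0 ->
  boundary d = 0 -> (forall w, u \notin w -> v \notin w -> d (v |: w) = 0) ->
  d = 0.
Proof.
move=> d0 fd dd dv; apply/ffunP => s; rewrite [RHS]ffunE.
(* A simplex with [u] but not [v] has a mirror on which [d] is 0; one with neither vertex is the
   only simplex mapped onto itself. *)
have dnv t : v \notin t -> d t = 0.
  move=> vt; have [Kt | /d0 //] := boolP (t \in K).
  have [ut | ut] := boolP (u \in t).
    rewrite -(setD1K ut) collapse_mirror ?dv // !inE ?eqxx //.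
    by rewrite negb_and vt orbT.
    by rewrite negb_and vt orbT.
  have /ffunP/(_ t) := fd; rewrite !ffunE (bigD1 t) /=; last first.
    by rewrite imset_collapse // (negPf vt) !eqxx.
  rewrite big1 ?addr0 // => r /andP[/andP[/eqP fr _] ne_rt].
  have [Kr | /d0 //] := boolP (r \in K).
  move: fr; rewrite imset_collapse //; case: ifP => _ fr.
    by rewrite -fr setU11 in ut.
  by rewrite fr eqxx in ne_rt.
have [vs | /dnv //] := boolP (v \in s).
have [us | us] := boolP (u \in s); last first.
  by rewrite -(setD1K vs) dv // !inE ?eqxx // negb_and us orbT.
have sv0 : s :\ v != set0 by apply/set0Pn; exists u; rewrite !inE ne_uv.
have /ffunP/(_ (s :\ v)) := dd; rewrite !ffunE (bigD1 s) /=; last first.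
  by rewrite /facet sv0 subsetDl (cardsD1 v s) vs /=.
rewrite big1 ?addr0 // => t /andP[/and3P[_ svt /eqP ct] ne_ts].
apply: dnv; apply: contra ne_ts => vt; rewrite eq_sym eqEcard ct.
rewrite (cardsD1 v s) vs leqnn andbT.
by apply/subsetP => x xs; have [-> // | nx] := eqVneq x v;
  apply: (subsetP svt); rewrite !inE nx.
Qed.

Hypothesis f_surj :
  forall t, t \in K' -> exists2 s, s \in K & #|s| = #|t| /\ f @: s = t.

(** An arbitrary lift [c] is corrected by the cone over its boundary. The cone is invisible after
    the collapse, and the remaining boundary meets the assumptions of [collapsed_cycle_eq0]. *)
Lemma collapse_lift_cycles p z' : z' \in cycles K' p ->
  exists2 z, z \in cycles K p & pushc f z = z'.
Proof.
rewrite mem_cycles => /andP[K'z' /eqP dz'].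
have [c Kc fc] := pushc_lift f_surj K'z'; set k := boundary c.
have k0 : supported k K by apply: boundary_supported cK (chains_supported Kc).
have fk : pushc f k = 0 by rewrite -boundary_pushc fc.
have h0 := cone_supported k0 fk.
have fh := pushc_cone h0.
(* The coefficient of [k] at [s :\ u] sums coefficients of [c] on sets of the size of [s], so the
   cone has the dimension of [c]. *)
have Kh : cone k \in chains K p.
  apply/mem_chainsP => s; rewrite mem_simplices negb_and.
  case/orP => [/h0 // | ps]; rewrite ffunE; case: ifP => // /andP[us vs].
  rewrite ffunE big1 // => t /and3P[_ _ /eqP ct]; apply: (chains_out Kc).
  rewrite mem_simplices negb_and /sdim ct; apply/orP; right; apply: contra ps.
  by rewrite /sdim (cardsD1 u s) us.
have fz : pushc f (c - cone k) = z' by rewrite [LHS]linearB /= fc fh subr0.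
exists (c - cone k) => //; rewrite mem_cycles memvB //=; apply/eqP.
apply: collapsed_cycle_eq0.
- apply: boundary_supported => // s Ks.
  by rewrite chain_subE h0 // (chains_supported Kc Ks) subr0.
- by rewrite -boundary_pushc fz.
- exact: boundary_boundary.
by move=> w uw vw; rewrite boundaryB chain_subE boundary_cone_mirror // subrr.
Qed.

(** The boundary of [u |: (v |: w)] has zero annotation. All its facets except the two mirror
    simplices contain both [u] and [v] and contribute 0, so the two remaining vectors are equal. *)
Lemma mirror_vec p L w : annotates K p L ->
  (forall s, s \in simplices K p -> u \in s -> v \in s -> vec L s = 0) ->
  u \notin w -> v \notin w ->
  u |: w \in simplices K p -> v |: w \in simplices K p ->
  vec L (u |: w) = vec L (v |: w).
Proof.
move=> [ker _] van uw vw; rewrite !mem_simplices => /andP[Ku pu] /andP[Kv pv].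
set s := u |: (v |: w).
have uvw : u \notin v |: w by rewrite !inE (negPf ne_uv).
have vuw : v \notin u |: w by rewrite !inE eq_sym (negPf ne_uv).
have cs : #|s| = #|w|.+2 by rewrite /s cardsU1 uvw cardsU1 vw.
have ps : sdim s = p.+1.
  by rewrite -(eqP pv) /sdim cs cardsU1 vw.
have Ks : s \in simplices K p.+1
  by rewrite mem_simplices link_condition // ps eqxx.
have : ann_chain L (boundary (schain s)) = 0.
  apply/ker; first exact: boundary_cycle cK (schain_chains Ks).
  by apply/mem_boundariesP; exists (schain s); rewrite ?schain_chains.
have dsE t : boundary (schain s) t = (facet t s)%:R.
  rewrite ffunE big_mkcond (bigD1 s) //= schainE eqxx big1 ?addr0 => [|r nr].
    by case: facet.
  by rewrite schainE (negPf nr) if_same.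
have fuw : facet (u |: w) s.
  rewrite /facet /s setUCA subsetUr setUCA cs cardsU1 uw eqxx !andbT.
  by apply/set0Pn; exists u; rewrite setU11.
have fvw : facet (v |: w) s.
  rewrite /facet /s subsetUr cs cardsU1 vw eqxx !andbT.
  by apply/set0Pn; exists v; rewrite setU11.
have ne_uvw : u |: w != v |: w by apply: contraNneq vuw => ->; rewrite setU11.
rewrite /ann_chain (bigD1 (u |: w)) //= (bigD1 (v |: w)) /=;
  last by rewrite eq_sym.
rewrite !dsE fuw fvw !scale1r big1 ?addr0 => [/eqP|t /andP[ntu ntv]];
  last first.
  rewrite dsE; case: (boolP (facet t s)) => [/and3P[t0 ts /eqP ct] | _];
    last by rewrite scale0r.
  have {}ct : #|t| = #|w|.+1 by move: ct; rewrite cs => -[].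
  rewrite van ?scaler0 //.
  - rewrite mem_simplices (proj2 cK s) //; last exact: link_condition.
    by move: ps; rewrite /sdim cs ct => -[->] /=.
  - apply: contraNT ntv => ut; rewrite eqEcard ct cardsU1 vw leqnn andbT.
    apply/subsetP => x xt; move/subsetP/(_ x xt): ts.
    by rewrite inE in_set1 => /predU1P[ex|//]; rewrite -ex xt in ut.
  apply: contraNT ntu => vt; rewrite eqEcard ct cardsU1 uw leqnn andbT.
  apply/subsetP => x xt; move/subsetP/(_ x xt): ts.
  by rewrite /s setUCA inE in_set1 => /predU1P[ex|//]; rewrite -ex xt in vt.
by rewrite addr_eq0 => /eqP ->; apply/rowP => i; rewrite mxE F2_oppr.
Qed.

Lemma collapse_annotates p L : simplicial_map f K K' ->
  (forall s, s \in simplices K p -> u \in s -> v \in s -> vec L s = 0) ->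
  annotates K p L -> annotates K' p (push_layer f K L).
Proof.
move=> fK van ann.
apply: push_annotates (ann) => //; first exact: collapse_lift_cycles.
- move=> s Ks; have := Ks; rewrite mem_simplices => /andP[Ks' _].
  by rewrite card_collapse // negbK => /andP[]; apply: van.
move=> r s Kr Ks /eqP cr /eqP cs frs.
have Kr' : r \in K by move: Kr; rewrite mem_simplices => /andP[].
have Ks' : s \in K by move: Ks; rewrite mem_simplices => /andP[].
move: cr cs frs; rewrite !card_collapse // !imset_collapse //.
(* Two distinct simplices with the same image, neither containing both [u] and [v], are mirrors: one
   contains [v], the other [u] in its place. *)
have mirror r' s' : r' \in simplices K p -> s' \in simplices K p ->
    u \notin r' -> v \in r' -> v \notin s' ->
    u |: (r' :\ v) = s' -> vec L r' = vec L s'.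
  move=> Kr'' Ks'' ur vr vs es; rewrite -es -[in LHS](setD1K vr);
    apply/esym/(mirror_vec ann) => //.
  - by rewrite !inE negb_and ur orbT.
  - by rewrite !inE eqxx.
  - by rewrite es.
  by rewrite setD1K.
have [vr | vr] := boolP (v \in r); have [vs | vs] := boolP (v \in s);
  rewrite ?andbT ?andbF.
- move=> ur us e; congr (vec L _); rewrite -(setD1K vr) -(setD1K vs);
    congr (_ |: _).
  have u_del w : u \notin w -> u \notin w :\ v by move=> uw;
    rewrite !inE negb_and uw orbT.
  by rewrite -(setU1K (u_del r ur)) e setU1K // u_del.
- by move=> ur _ e; apply: mirror.
- by move=> _ us e; apply/esym/mirror.
by move=> _ _ ->.
Qed.

End Collapse.

(** * Enforcing the link condition *)

Section LinkCompletion.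
Variables (V : finType) (K : {set {set V}}) (u v : V).
Implicit Types (s t w : {set V}).
Hypothesis cK : simplicial_complex K.
Hypothesis ne_uv : u != v.
Hypothesis Ku : [set u] \in K.
Hypothesis Kv : [set v] \in K.

Let Khat := K :|: missing_simplices K u v.

(** Allowing [w] to be empty treats the edge between [u] and [v] like the other missing simplices;
    [link] itself has nonempty members only. *)
Lemma missingP s :
  reflect (s \notin K /\ exists w,
             [/\ u \notin w, v \notin w, s = u |: (v |: w), u |: w \in K
               & v |: w \in K])
          (s \in missing_simplices K u v).
Proof.
rewrite in_setD in_setU1; apply: (iffP andP) => -[Ks].
  case/predU1P => [es | /imsetP[w]].
    by split=> //; exists set0; rewrite !inE !setU0.
  rewrite !inE => /and3P[/andP[Kw /andP[wu Kwu]] _ /andP[wv Kwv]] es.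
  rewrite disjoint_sym disjoints1 in wu; rewrite disjoint_sym disjoints1 in wv.
  split=> //; exists w; split=> //; try by rewrite setUC.
  by rewrite es setUC setUA.
case=> w [uw vw es Kuw Kvw]; split=> //.
have [w0 | w0] := eqVneq w set0; first by rewrite es w0 setU0 eqxx.
have Kw : w \in K by apply: (proj2 cK (u |: w)); rewrite // subsetUr.
apply/orP; right; apply/imsetP; exists w; last by rewrite es setUA setUC.
by rewrite !inE Kw !(disjoint_sym w) !disjoints1 uw vw !(setUC w) Kuw Kvw.
Qed.

Lemma missing_uv s : s \in missing_simplices K u v -> (u \in s) && (v \in s).
Proof. by case/missingP => _ [w [_ _ -> _ _]]; rewrite !inE !eqxx !orbT. Qed.

Lemma Khat_not_vanishing s :
  s \in Khat -> ~~ ((u \in s) && (v \in s)) -> s \in K.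
Proof. by case/setUP => // /missing_uv ->. Qed.

(** All added simplices contain both [u] and [v], so the premises hold already in [K], and a single
    round of insertions suffices. *)
Lemma Khat_link w : u \notin w -> v \notin w ->
  u |: w \in Khat -> v |: w \in Khat -> u |: (v |: w) \in Khat.
Proof.
move=> uw vw /Khat_not_vanishing Kuw /Khat_not_vanishing Kvw.
rewrite inE; apply/orP; have [|nK] := boolP (u |: (v |: w) \in K);
  [by left | right].
apply/missingP; split=> //; exists w; split=> //.
  by apply: Kuw; rewrite !inE negb_and eq_sym (negPf ne_uv) vw orbT.
by apply: Kvw; rewrite !inE negb_and (negPf ne_uv) uw.
Qed.

(** A face of an added simplex that omits [u] or [v] is a face of a simplex of [K]; one that
    contains both is covered by [Khat_link]. *)
Lemma Khat_complex : simplicial_complex Khat.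
Proof.
split=> [|s t].
  apply/setUP => -[K0 | /missing_uv]; last by rewrite inE.
  by rewrite (negPf (proj1 cK)) in K0.
case/setUP => [Ks ts t0 | /missingP[_ [w [uw vw -> Kuw Kvw]]] ts t0].
  by rewrite inE (proj2 cK s t).
have sub x r : t \subset x |: r -> x \notin t -> t \subset r.
  move=> tr xt; apply/subsetP => y yt; move/subsetP/(_ y yt): tr.
  by rewrite in_setU1 => /predU1P[eyx|//]; rewrite -eyx yt in xt.
have [ut | ut] := boolP (u \in t); last first.
  by rewrite inE (proj2 cK (v |: w) t) // (sub u).
have [vt | vt] := boolP (v \in t); last first.
  by rewrite inE (proj2 cK (u |: w) t) // (sub v) // setUCA.
have [uw' vw' _ tE] := setD1_split ne_uv ut vt.
set w' := t :\ u :\ v in uw' vw' tE.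
have w'w : w' \subset w by rewrite !subDset.
have Kface x : x |: w \in K -> x |: w' \in Khat.
  move=> Kx; rewrite inE (proj2 cK (x |: w)) ?setUS //.
  by apply/set0Pn; exists x; rewrite setU11.
by rewrite tE; apply: Khat_link => //; apply: Kface.
Qed.

Lemma collapse_update_annotates (K' : {set {set V}}) (f : V -> V)
    (ss vs : seq {set V}) (a : annotation V) :
  (forall x, [set x] \in K -> f x = if x == v then u else x) ->
  simplicial_map f K K' ->
  (forall t, t \in K' -> exists2 s, s \in K & f @: s = t) ->
  perm_eq ss (enum (missing_simplices K u v)) ->
  sorted (fun s t => sdim s <= sdim t)%N ss ->
  perm_eq vs (enum (vanishing_simplices Khat u v)) ->
  (forall p, annotates K p (a p)) ->
  forall p, annotates K' p
    (push_annotation f Khat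
      (foldl (transfer Khat v) (foldl (@insert_simplex V) a ss) vs) p).
Proof.
move=> fE fK f_onto perm_ss sorted_ss perm_vs ann p.
have cKhat := Khat_complex.
have KhatE : Khat = K :|: [set:: ss].
  by apply/setP => s; rewrite !inE (perm_mem perm_ss) mem_enum !inE.
have fEhat x : [set x] \in Khat -> f x = if x == v then u else x.
  move=> Kx; apply/fE/(Khat_not_vanishing Kx); rewrite !in_set1.
  by apply: contra ne_uv => /andP[/eqP -> /eqP ->].
have vsE : vs =i vanishing_simplices Khat u v.
  by move=> s; rewrite (perm_mem perm_vs) mem_enum.
have sub_vs : {subset vs <= vanishing_simplices Khat u v} by move=> s;
  rewrite vsE.
apply: (collapse_annotates cKhat ne_uv fEhat Khat_link) => [t K't | s | s | ].
(* If the given preimage contains both [u] and [v], removing [v] leaves the image unchanged and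
   makes the sizes equal. *)
- have [s Ks fs] := f_onto t K't.
  have Khs : s \in Khat by rewrite inE Ks.
  have [/andP[us vs'] | nuv] := boolP ((u \in s) && (v \in s)); last first.
    by exists s; rewrite // -fs; split=> //; apply/esym/eqP;
      rewrite (card_collapse cKhat ne_uv fEhat).
  have usv : u \in s :\ v by rewrite !inE ne_uv.
  have Ksv : s :\ v \in Khat.
    apply: (proj2 cKhat s) => //; first exact: subsetDl.
    by apply/set0Pn; exists u.
  have fsv : f @: (s :\ v) = t.
    rewrite (imset_collapse cKhat fEhat) // !inE eqxx /= -fs.
    rewrite (imset_collapse cKhat fEhat) // vs'.
    by apply/esym/setUidPr; rewrite sub1set.
  exists (s :\ v); rewrite // -fsv; split=> //; apply/esym/eqP.
  by rewrite (card_collapse cKhat ne_uv fEhat) // !inE eqxx andbF.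
(* An added simplex has the same image as its face [v |: w], which is in [K]. *)
- case/setUP => [/fK // | /missingP[_ [w [uw vw -> Kuw Kvw]]]].
  rewrite imsetU1 fE // (negPf ne_uv).
  have := fK _ Kvw; rewrite imsetU1 fE // eqxx setUA setUid.
  by [].
- rewrite mem_simplices => /andP[Ks /eqP <-] us vs'.
  have van : s \in vanishing_simplices Khat u v by rewrite inE Ks us vs'.
  by apply: (transfers_vec (u := u)) => //; left; rewrite vsE.
apply: (transfers_annotates ne_uv sub_vs) => q.
rewrite KhatE; apply: inserts_annotates => //.
- by rewrite (perm_uniq perm_ss) enum_uniq.
- by move=> s; rewrite (perm_mem perm_ss) mem_enum inE => /andP[].
by rewrite -KhatE.
Qed.

End LinkCompletion.

(** * Cohomology bases under elementary updates *)

Theorem proposition5p1 (V : finType) (K K' : {set {set V}}) (f : V -> V)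
    (a a' : annotation V) (p : nat) :
  simplicial_complex K -> simplicial_complex K' ->
  elementary_map f K K' ->
  valid_annotation K a ->
  annotation_update f K K' a a' ->
  cohomology_basis K' p (ann_cochain K' p (L := a' p)).
Proof.
move=> cK cK' _ /valid_annotates ann upd;
  apply: annotates_cohomology_basis => //.
case: upd cK' => {a'} [[_ f_inj _] -> | s [fK f_inj _] K's |
  u v ss vs Khat [ne_uv [Ku Kv] fE fK f_onto] perm_ss sorted_ss perm_vs] cK'.
- exact: map_annotates.
(* The inclusion is split into a renaming of vertices and the insertion of [s]. *)
- have K'E : K' = s |: map_complex f K.
    rewrite -K's setUC -[LHS](setID K' (map_complex f K)); congr (_ :|: _).
    by apply/setIidPr/subsetP => t /imsetP[r /fK fr ->].
  have : s \in K' :\: map_complex f K by rewrite K's set11.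
  rewrite in_setD K'E => /andP[sK _]; rewrite K'E in cK'.
  apply: insert_annotates => //; first exact: map_complex_simplicial.
  exact: map_annotates.
apply: (collapse_update_annotates (u := u)); eassumption.
Qed.
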